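(* Let $\mathscr{A}$ be a connected cochain DG algebra over $k$. For any $M\in\mathscr{D}^c(\mathscr{A})$, $$\mathrm{gh.len}_{\mathscr{A}}M=\mathrm{level}^{\mathscr{A}}_{\mathscr{D}(\mathscr{A})}(M)-1.$$
   Context: $k$ is an algebraically closed field of characteristic $0$. A cochain DG algebra $\mathscr{A}$ is a $\mathbb{Z}$-graded $k$-algebra with a $k$-linear degree $1$ map $\partial_{\mathscr{A}}$ with $\partial_{\mathscr{A}}^2=0$ satisfying the graded Leibniz rule; it is connected if its underlying graded algebra satisfies $\mathscr{A}^i=0$ for $i<0$ and $\mathscr{A}^0=k$. DG $\mathscr{A}$-modules are left DG modules, with differential of degree $1$; $\mathscr{D}(\mathscr{A})$ is the derived category of DG $\mathscr{A}$-modules and $\mathscr{D}^c(\mathscr{A})$ its full subcategory of compact objects (those $M$ for which $\mathrm{Hom}_{\mathscr{D}(\mathscr{A})}(M,-)$ preserves all coproducts). $\Sigma$ denotes the suspension. Ghost length. A morphism $f$ in $\mathscr{D}(\mathscr{A})$ is ghost if $H(f)=0$. $\mathrm{gh.len}_{\mathscr{A}}M=n$ if every composite $M\to I_1\to\cdots\to I_{n+1}$ of $n+1$ ghosts is $0$ in $\mathscr{D}(\mathscr{A})$ and some composite of $n$ ghosts starting at $M$ is nonzero in $\mathscr{D}(\mathscr{A})$; $\mathrm{gh.len}_{\mathscr{A}}M=-1$ if $M\cong 0$ in $\mathscr{D}(\mathscr{A})$. Level. $\mathrm{add}(\mathscr{A})$ is the smallest strictly full subcategory of $\mathscr{D}(\mathscr{A})$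 containing $\mathscr{A}$ and closed under finite direct sums (including the empty one) and all suspensions. $\mathrm{smd}(\mathcal{C})$ is the smallest strictly full subcategory containing $\mathcal{C}$ and closed under direct summands. For strictly full subcategories, $\mathcal{S}\star\mathcal{T}$ consists of those $M$ for which there is an exact triangle $L\to M\to N\to\Sigma L$ with $L\in\mathcal{S}$, $N\in\mathcal{T}$, and $\mathcal{S}\diamond\mathcal{T}=\mathrm{smd}(\mathcal{S}\star\mathcal{T})$. Put $\langle\mathscr{A}\rangle_0=0$ (the zero objects), $\langle\mathscr{A}\rangle_1=\mathrm{smd}(\mathrm{add}(\mathscr{A}))$, and $\langle\mathscr{A}\rangle_n=\langle\mathscr{A}\rangle_{n-1}\diamond\langle\mathscr{A}\rangle_1$ for $n\ge2$. Then $\mathrm{level}^{\mathscr{A}}_{\mathscr{D}(\mathscr{A})}(M)=\inf\{n\in\mathbb{Z}_{\ge 0}\mid M\in\langle\mathscr{A}\rangle_n\}$. *)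

(* Defs.v *)
From HB Require Import structures.
From mathcomp Require Import all_boot all_order all_algebra.
From mathcomp Require Import boolp classical_sets constructive_ereal.

Set Implicit Arguments.
Unset Strict Implicit.
Unset Printing Implicit Defensive.

Import Order.TTheory GRing.Theory Num.Theory.
Local Open Scope ring_scope.

(* A graded object is a family of k-spaces indexed by [int].  Every operation
   that moves degrees takes the equation relating the degrees as an argument,
   so that the axioms need no transport between e.g. the degrees (i + j) + l
   and i + (j + l).  Equations in [int] are proof irrelevant, so these
   arguments carry no information. *)

Record dgAlgebra (k : fieldType) := DGAlgebra {
  alg_sort :> int -> lmodType k;
  alg_one : alg_sort 0;
  alg_mul : forall i j l : int, i + j = l ->
    alg_sort i -> alg_sort j -> alg_sort l;
  alg_d : forall i j : int, i + 1 = j -> alg_sort i -> alg_sort j;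
  alg_mul_linearr : forall i j l (e : i + j = l) a, linear (alg_mul e a);
  alg_mul_linearl : forall i j l (e : i + j = l) b,
    linear (fun a => alg_mul e a b);
  alg_mul1l : forall i (e : 0 + i = i) a, alg_mul e alg_one a = a;
  alg_mul1r : forall i (e : i + 0 = i) a, alg_mul e a alg_one = a;
  alg_mulA : forall i j l ij jl ijl (e1 : j + l = jl) (e2 : i + jl = ijl)
      (e3 : i + j = ij) (e4 : ij + l = ijl) a b c,
    alg_mul e2 a (alg_mul e1 b c) = alg_mul e4 (alg_mul e3 a b) c;
  alg_d_linear : forall i j (e : i + 1 = j), linear (alg_d e);
  alg_d_d : forall i j l (e1 : i + 1 = j) (e2 : j + 1 = l) a,
    alg_d e2 (alg_d e1 a) = 0;
  alg_leibniz : forall i j l i' j' l' (e : i + j = l) (ei : i + 1 = i')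
      (ej : j + 1 = j') (el : l + 1 = l') (e1 : i' + j = l')
      (e2 : i + j' = l') a b,
    alg_d el (alg_mul e a b) =
      alg_mul e1 (alg_d ei a) b + (-1) ^ i *: alg_mul e2 a (alg_d ej b)
}.

Definition connected_dga (k : fieldType) (A : dgAlgebra k) : Prop :=
  (forall i : int, i < 0 -> forall a : A i, a = 0) /\
  bijective (fun c : k => c *: alg_one A).

Record dgModule (k : fieldType) (A : dgAlgebra k) := DGModule {
  mod_sort :> int -> lmodType k;
  mod_act : forall i j l : int, i + j = l -> A i -> mod_sort j -> mod_sort l;
  mod_d : forall i j : int, i + 1 = j -> mod_sort i -> mod_sort j;
  mod_act_linearr : forall i j l (e : i + j = l) a, linear (mod_act e a);
  mod_act_linearl : forall i j l (e : i + j = l) x,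
    linear (fun a => mod_act e a x);
  mod_act1 : forall i (e : 0 + i = i) x, mod_act e (alg_one A) x = x;
  mod_actA : forall i j l ij jl ijl (e1 : j + l = jl) (e2 : i + jl = ijl)
      (e3 : i + j = ij) (e4 : ij + l = ijl) a b x,
    mod_act e2 a (mod_act e1 b x) = mod_act e4 (alg_mul e3 a b) x;
  mod_d_linear : forall i j (e : i + 1 = j), linear (mod_d e);
  mod_d_d : forall i j l (e1 : i + 1 = j) (e2 : j + 1 = l) x,
    mod_d e2 (mod_d e1 x) = 0;
  mod_leibniz : forall i j l i' j' l' (e : i + j = l) (ei : i + 1 = i')
      (ej : j + 1 = j') (el : l + 1 = l') (e1 : i' + j = l')
      (e2 : i + j' = l') a x,
    mod_d el (mod_act e a x) =
      mod_act e1 (alg_d ei a) x + (-1) ^ i *: mod_act e2 a (mod_d ej x)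
}.

HB.instance Definition _ (k : fieldType) (A : dgAlgebra k) (M : dgModule A)
    (i j : int) (e : i + 1 = j) :=
  GRing.isLinear.Build k (M i) (M j) *:%R (@mod_d k A M i j e)
    (@mod_d_linear k A M i j e).

HB.instance Definition _ (k : fieldType) (A : dgAlgebra k) (M : dgModule A)
    (i j l : int) (e : i + j = l) (a : A i) :=
  GRing.isLinear.Build k (M j) (M l) *:%R (@mod_act k A M i j l e a)
    (@mod_act_linearr k A M i j l e a).

Record dgHom (k : fieldType) (A : dgAlgebra k) (M N : dgModule A) := DGHom {
  hom_fun :> forall i : int, M i -> N i;
  hom_linear : forall i, linear (@hom_fun i);
  hom_act : forall i j l (e : i + j = l) a x,
    @hom_fun l (mod_act e a x) = mod_act e a (@hom_fun j x);
  hom_d : forall i j (e : i + 1 = j) x,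
    @hom_fun j (mod_d e x) = mod_d e (@hom_fun i x)
}.

Arguments hom_fun {k A M N} f i x : rename.

HB.instance Definition _ (k : fieldType) (A : dgAlgebra k) (M N : dgModule A)
    (f : dgHom M N) (i : int) :=
  GRing.isLinear.Build k (M i) (N i) *:%R (@hom_fun k A M N f i)
    (@hom_linear k A M N f i).

Section DGModules.
Variables (k : fieldType) (A : dgAlgebra k).
Implicit Types M N P Q L X Y : dgModule A.

Program Definition hom_id M : dgHom M M := @DGHom k A M M (fun _ x => x) _ _ _.
Next Obligation. by []. Qed.

Program Definition hom_comp M N P (g : dgHom N P) (f : dgHom M N) : dgHom M P :=
  @DGHom k A M P (fun i x => g i (f i x)) _ _ _.
Next Obligation. by move=> c x y; rewrite !linearP. Qed.
Next Obligation. by rewrite !hom_act. Qed.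
Next Obligation. by rewrite !hom_d. Qed.

Program Definition hom_zero M N : dgHom M N :=
  @DGHom k A M N (fun _ _ => 0) _ _ _.
Next Obligation. by move=> ? ? ?; rewrite scaler0 addr0. Qed.
Next Obligation. by rewrite linear0. Qed.
Next Obligation. by rewrite linear0. Qed.

Program Definition hom_opp M N (f : dgHom M N) : dgHom M N :=
  @DGHom k A M N (fun i x => - f i x) _ _ _.
Next Obligation. by move=> c x y; rewrite linearP opprD scalerN. Qed.
Next Obligation. by rewrite hom_act linearN. Qed.
Next Obligation. by rewrite hom_d linearN. Qed.

Program Definition hom_add M N (f g : dgHom M N) : dgHom M N :=
  @DGHom k A M N (fun i x => f i x + g i x) _ _ _.
Next Obligation. by move=> c x y; rewrite !linearP addrACA scalerDr. Qed.
Next Obligation. by rewrite !hom_act linearD. Qed.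
Next Obligation. by rewrite !hom_d linearD. Qed.

(* A-linear maps of degree -1 satisfy h (a x) = (-1)^|a| a h(x). *)
Definition homotopic M N (f g : dgHom M N) : Prop :=
  exists h : forall i j : int, j + 1 = i -> M i -> N j,
  [/\ forall i j (e : j + 1 = i), linear (h i j e),
      forall i j l j' l' (e : i + j = l) (e' : i + j' = l')
        (ej : j' + 1 = j) (el : l' + 1 = l) a x,
        h l l' el (mod_act e a x) = (-1) ^ i *: mod_act e' a (h j j' ej x) &
      forall i j l (e1 : j + 1 = i) (e2 : i + 1 = l) x,
        f i x - g i x = mod_d e1 (h i j e1 x) + h l i e2 (mod_d e2 x)].

Definition cocycle M i (x : M i) : Prop :=
  forall j (e : i + 1 = j), mod_d e x = 0.
Definition coboundary M i (x : M i) : Prop :=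
  exists j (e : j + 1 = i) (y : M j), x = mod_d e y.
Definition cohomologous M i (x y : M i) : Prop := coboundary (x - y).

(* H^i(f) is bijective for all i; H^i(M) is the set of cocycles of degree i up
   to [cohomologous]. *)
Definition quasi_iso M N (f : dgHom M N) : Prop := forall i : int,
  (forall x y : M i, cocycle x -> cocycle y ->
     cohomologous (f i x) (f i y) -> cohomologous x y) /\
  (forall y : N i, cocycle y ->
     exists2 x : M i, cocycle x & cohomologous (f i x) y).

Fact row0_eq (x y : 'rV[k]_0) : x = y.
Proof. by rewrite [x]thinmx0 [y]thinmx0. Qed.

Program Definition dgm_zero : dgModule A :=
  @DGModule k A (fun _ => 'rV[k]_0) (fun _ _ _ _ _ _ => 0) (fun _ _ _ _ => 0)
    _ _ _ _ _ _ _.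
Next Obligation. by move=> ? ? ?; rewrite scaler0 addr0. Qed.
Next Obligation. by move=> ? ? ?; rewrite scaler0 addr0. Qed.
Next Obligation. exact: row0_eq. Qed.
Next Obligation. by move=> ? ? ?; rewrite scaler0 addr0. Qed.
Next Obligation. exact: row0_eq. Qed.

Definition dgm_regular : dgModule A :=
  @DGModule k A A (@alg_mul k A) (@alg_d k A)
    (@alg_mul_linearr k A) (@alg_mul_linearl k A) (@alg_mul1l k A)
    (@alg_mulA k A) (@alg_d_linear k A) (@alg_d_d k A) (@alg_leibniz k A).

Fact addKl_deg (n i j l : int) : i + j = l -> i + (j + n) = l + n.
Proof. by move<-; rewrite addrA. Qed.

Fact addKr_deg (n i j : int) : i + 1 = j -> i + n + 1 = j + n.
Proof. by move<-; rewrite addrAC. Qed.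

Lemma mod_act_lin M i j l (e : i + j = l) c (a b : A i) (x : M j) :
  mod_act e (c *: a + b) x = c *: mod_act e a x + mod_act e b x.
Proof. exact: (mod_act_linearl e x c a b). Qed.

Lemma mod_actZ M i j l (e : i + j = l) (a : A i) c (x : M j) :
  mod_act e a (c *: x) = c *: mod_act e a x.
Proof. exact: linearZ. Qed.

(* The n-th suspension: degree i is M (i + n), the differential is multiplied by
   (-1)^n and a acts on the left with the sign (-1)^(n |a|). *)
Program Definition shift (n : int) M : dgModule A :=
  @DGModule k A (fun i => M (i + n))
    (fun i j l e a x => (-1) ^ (n * i) *: mod_act (addKl_deg n e) a x)
    (fun i j e x => (-1) ^ n *: mod_d (addKr_deg n e) x)
    _ _ _ _ _ _ _.
Next Obligation.
by move=> c x y; rewrite linearP scalerDr !scalerA mulrC.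
Qed.
Next Obligation.
by move=> c a b /=; rewrite mod_act_lin scalerDr !scalerA mulrC.
Qed.
Next Obligation. by rewrite mulr0 expr0z scale1r mod_act1. Qed.
Next Obligation.
rewrite linearZ /= scalerA -expfzDr ?oppr_eq0 ?oner_eq0 // -mulrDr.
by rewrite (mod_actA _ _ erefl (addKl_deg n e4)).
Qed.
Next Obligation.
by move=> c x y; rewrite linearP scalerDr !scalerA mulrC.
Qed.
Next Obligation. by rewrite linearZ /= mod_d_d !scaler0. Qed.
Next Obligation.
rewrite linearZ /= (mod_leibniz _ erefl (addKr_deg n erefl)
  (addKr_deg n erefl) (addKl_deg n e1) (addKl_deg n e2)).
rewrite mod_actZ !scalerDr !scalerA mulrDr mulr1.
rewrite expfzDr ?oppr_eq0 ?oner_eq0 //; congr (_ *: _ + _ *: _).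
  by rewrite mulrC.
by rewrite mulrC [X in _ * X]mulrC mulrA.
Qed.

Program Definition shift_hom (n : int) M N (f : dgHom M N) :
    dgHom (shift n M) (shift n N) :=
  @DGHom k A (shift n M) (shift n N) (fun i x => f (i + n) x) _ _ _.
Next Obligation. by move=> c x y; rewrite linearP. Qed.
Next Obligation. by rewrite linearZ /= hom_act. Qed.
Next Obligation. by rewrite linearZ /= hom_d. Qed.

Program Definition dsum M N : dgModule A :=
  @DGModule k A (fun i => (M i * N i)%type)
    (fun i j l e a p => (mod_act e a p.1, mod_act e a p.2))
    (fun i j e p => (mod_d e p.1, mod_d e p.2))
    _ _ _ _ _ _ _.
Next Obligation. by move=> c p q /=; rewrite !linearP. Qed.
Next Obligation. by move=> c a b /=; rewrite !mod_act_lin. Qed.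
Next Obligation. by rewrite !mod_act1. Qed.
Next Obligation.
by congr pair; apply: mod_actA.
Qed.
Next Obligation. by move=> c p q /=; rewrite !linearP. Qed.
Next Obligation. by rewrite !mod_d_d. Qed.
Next Obligation.
by congr pair; apply: mod_leibniz.
Qed.

Program Definition hom_pair M N P (f : dgHom M N) (g : dgHom M P) :
    dgHom M (dsum N P) :=
  @DGHom k A M (dsum N P) (fun i x => (f i x, g i x)) _ _ _.
Next Obligation. by move=> c x y; rewrite !linearP. Qed.
Next Obligation. by rewrite !hom_act. Qed.
Next Obligation. by rewrite !hom_d. Qed.

Definition hom_inl M N : dgHom M (dsum M N) := hom_pair (hom_id M) (hom_zero M N).
Definition hom_inr M N : dgHom N (dsum M N) := hom_pair (hom_zero N M) (hom_id N).

Definition deg_cast M i j (e : i = j) (x : M i) : M j := ecast j (M j) e x.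

(* cone f = N (+) Sigma M with d (y, x) = (d y + f x, - d x). *)
Program Definition cone M N (f : dgHom M N) : dgModule A :=
  @DGModule k A (fun i => (N i * shift 1 M i)%type)
    (fun i j l e a p => (mod_act e a p.1, mod_act e a p.2))
    (fun i j e p => (mod_d e p.1 + deg_cast e (f (i + 1) p.2), mod_d e p.2))
    _ _ _ _ _ _ _.
Next Obligation.
move=> c p q; congr pair; first exact: mod_act_linearr.
exact: (@mod_act_linearr k A (shift 1 M)).
Qed.
Next Obligation.
move=> c a b; congr pair; first exact: mod_act_linearl.
exact: (@mod_act_linearl k A (shift 1 M)).
Qed.
Next Obligation.
congr pair; first exact: mod_act1.
exact: (@mod_act1 k A (shift 1 M)).
Qed.
Next Obligation.
congr pair; first exact: mod_actA.
exact: (@mod_actA k A (shift 1 M)).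
Qed.
Next Obligation.
move=> c p q; congr pair; last exact: (@mod_d_linear k A (shift 1 M)).
by rewrite /= !linearP /= addrACA scalerDr.
Qed.
Next Obligation.
congr pair; last exact: (@mod_d_d k A (shift 1 M)).
rewrite /= linearD /= mod_d_d add0r linearZ /= expr1z scaleN1r hom_d.
by rewrite (eq_irrelevance (addKr_deg 1 erefl) erefl) subrr.
Qed.
Next Obligation.
congr pair; last exact: (@mod_leibniz k A (shift 1 M)).
rewrite /= (mod_leibniz _ erefl erefl _ e1 e2) linearD scalerDr.
rewrite -[LHS]addrA; congr (_ + (_ + _)); rewrite linearZ /= hom_act mul1r.
by rewrite (eq_irrelevance (addKl_deg 1 erefl) e2).
Qed.

Program Definition cone_in M N (f : dgHom M N) : dgHom N (cone f) :=
  @DGHom k A N (cone f) (fun i y => (y, 0)) _ _ _.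
Next Obligation.
move=> c x y; congr pair; transitivity (c *: 0 + 0 : M (i + 1)) => //.
by rewrite scaler0 addr0.
Qed.
Next Obligation. by rewrite [mod_act _ a 0]linear0 scaler0. Qed.
Next Obligation. by rewrite [mod_d _ 0]linear0 [f _ 0]linear0 scaler0 addr0. Qed.

Program Definition cone_out M N (f : dgHom M N) : dgHom (cone f) (shift 1 M) :=
  @DGHom k A (cone f) (shift 1 M) (fun i p => p.2) _ _ _.
Next Obligation. by []. Qed.

Lemma quasi_iso_id M : quasi_iso (hom_id M).
Proof.
move=> i; split=> // y cy; exists y => //; rewrite /cohomologous subrr.
by exists (i - 1), (subrK 1 i), 0; rewrite linear0.
Qed.

Lemma hom_cocycle M N (f : dgHom M N) i (x : M i) :
  cocycle x -> cocycle (f i x).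
Proof. by move=> cx j e; rewrite -hom_d cx linear0. Qed.

Lemma hom_coboundary M N (f : dgHom M N) i (x : M i) :
  coboundary x -> coboundary (f i x).
Proof. by move=> [j [e [y ->]]]; exists j, e, (f j y); rewrite hom_d. Qed.

Lemma hom_cohomologous M N (f : dgHom M N) i (x y : M i) :
  cohomologous x y -> cohomologous (f i x) (f i y).
Proof. by move=> /(hom_coboundary f); rewrite linearB. Qed.

Lemma cohomologous_trans M i (y x z : M i) :
  cohomologous x y -> cohomologous y z -> cohomologous x z.
Proof.
move=> [j [e [u xy]]] [j' [e' [v yz]]]; rewrite /cohomologous.
have jj : j' = j by apply: (addIr 1); rewrite e e'.
case: j / jj e u xy => e u xy; exists j', e', (u + v).
by rewrite linearD /= -yz (eq_irrelevance e' e) -xy addrA subrK.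
Qed.

Lemma quasi_iso_comp M N P (g : dgHom N P) (f : dgHom M N) :
  quasi_iso g -> quasi_iso f -> quasi_iso (hom_comp g f).
Proof.
move=> qg qf i; split=> [x y cx cy /= | z cz].
  move/(proj1 (qg i) _ _ (hom_cocycle f cx) (hom_cocycle f cy)).
  exact: (proj1 (qf i)).
have [y cy yz] := proj2 (qg i) z cz; have [x cx xy] := proj2 (qf i) y cy.
exists x => //=; apply: cohomologous_trans yz.
exact: hom_cohomologous.
Qed.

Lemma shift_cocycle n M i (x : shift n M i) :
  @cocycle (shift n M) i x <-> @cocycle M (i + n) x.
Proof.
split=> cx j e; last by rewrite /= cx scaler0.
have [m jE] : exists m, j = m + n by exists (j - n); rewrite subrK.
move: e; rewrite jE => e; have e' : i + 1 = m by apply: (addIr n); rewrite -e addrAC.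
apply/eqP; have /eqP := cx m e'; rewrite /= scaler_eq0 expfz_eq0.
rewrite oppr_eq0 oner_eq0 andbF /=.
by rewrite (eq_irrelevance (addKr_deg n e') e).
Qed.

Lemma shift_coboundary n M i (x : shift n M i) :
  @coboundary (shift n M) i x <-> @coboundary M (i + n) x.
Proof.
have u : (-1) ^ n != 0 :> k by rewrite expfz_eq0 oppr_eq0 oner_eq0 andbF.
split=> [[j [e [y ->]]]|[j [e [y ->]]]].
  by exists (j + n), (addKr_deg n e), ((-1) ^ n *: y); rewrite linearZ.
have [m jE] : exists m, j = m + n by exists (j - n); rewrite subrK.
move: e y; rewrite jE => e y; have e' : m + 1 = i by apply: (addIr n); rewrite -e addrAC.
exists m, e', (((-1) ^ n)^-1 *: y); rewrite /= linearZ /=.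
by rewrite scalerA divff // scale1r (eq_irrelevance (addKr_deg n e') e).
Qed.

Lemma quasi_iso_shift n M N (f : dgHom M N) :
  quasi_iso f -> quasi_iso (shift_hom n f).
Proof.
move=> qf i; split=> [x y cx cy fxy|y cy].
  apply/shift_coboundary; apply: (proj1 (qf (i + n))); try exact/shift_cocycle.
  exact/shift_coboundary.
have [x cx xy] := proj2 (qf (i + n)) y (proj1 (shift_cocycle y) cy).
by exists x; [apply/shift_cocycle | apply/shift_coboundary].
Qed.

(* The homotopy pushout of P <-s- N -g-> Q. *)
Definition hpush N P Q (s : dgHom N P) (g : dgHom N Q) : dgModule A :=
  cone (hom_pair s (hom_opp g)).
Definition hpush_inl N P Q (s : dgHom N P) (g : dgHom N Q) :
    dgHom P (hpush s g) :=
  hom_comp (cone_in (hom_pair s (hom_opp g))) (hom_inl P Q).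
Definition hpush_inr N P Q (s : dgHom N P) (g : dgHom N Q) :
    dgHom Q (hpush s g) :=
  hom_comp (cone_in (hom_pair s (hom_opp g))) (hom_inr P Q).

Lemma add0_eqN (V : zmodType) (x y : V) : x + y = 0 -> y = - x.
Proof. by move=> /eqP; rewrite addrC addr_eq0 => /eqP. Qed.

Lemma coboundary_down M i j (e : i + 1 = j) (x : M j) :
  coboundary x -> exists y : M i, x = mod_d e y.
Proof.
move=> [i' [e' [y ->]]]; have ii : i' = i by apply: (addIr 1); rewrite e e'.
by move: e'; rewrite -ii in e *; exists y; rewrite (eq_irrelevance e e').
Qed.

Lemma hpush_dE N P Q (s : dgHom N P) (g : dgHom N Q) i (p : P i) (q : Q i)
    (n : N (i + 1)) :
  @mod_d k A (hpush s g) i (i + 1) erefl ((p, q), n) =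
  ((mod_d erefl p + s _ n, mod_d erefl q - g _ n), - mod_d erefl n).
Proof.
rewrite /= expr1z scaleN1r.
by rewrite (eq_irrelevance (addKr_deg 1 erefl) erefl).
Qed.

Lemma hpush_quasi_iso N P Q (s : dgHom N P) (g : dgHom N Q) :
  quasi_iso s -> quasi_iso (hpush_inr s g).
Proof.
move=> qs i; split.
  move=> x y cx cy [j [e [[[p q] n]]]].
  case: i / e x y cx cy => x y cx cy; rewrite hpush_dE => -[e1 e2 e3].
  change (GRing.Lmodule.sort (N (j + 1))) in n; have dn : mod_d erefl n = 0.
    apply/eqP; rewrite -oppr_eq0; apply/eqP; rewrite -[RHS](subrr 0).
    exact: esym e3.
  have cn : cocycle n.
    by move=> l e; case: l / e.
  have sn : cohomologous (s _ n) (s _ 0).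
    rewrite /cohomologous linear0 subr0; exists j, erefl, (- p).
    by rewrite linearN; apply: add0_eqN; rewrite -e1 subrr.
  have c0 : cocycle (0 : N (j + 1)) by move=> l e; rewrite linear0.
  have [m nE] := coboundary_down erefl (proj1 (qs _) _ _ cn c0 sn).
  move: nE; rewrite subr0 => nE.
  exists j, erefl, (q - g _ m); rewrite linearB /= -hom_d -nE.
  exact: e2.
move=> [[p q] n] cw.
change (GRing.Lmodule.sort (N (i + 1))) in n; have := cw _ erefl; rewrite hpush_dE => -[e1 e2 e3].
have cn : cocycle n.
  move=> l e; case: l / e; apply: oppr_inj; rewrite oppr0.
  exact: e3.
have [j ij] : exists j, j + 1 = i by exists (i - 1); rewrite subrK.
have sn : cohomologous (s _ n) (s _ 0).
  rewrite /cohomologous linear0 subr0; exists i, erefl, (- p).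
  by rewrite linearN; apply: add0_eqN.
have c0 : cocycle (0 : N (i + 1)) by move=> l e; rewrite linear0.
have [m] := coboundary_down erefl (proj1 (qs _) _ _ cn c0 sn).
rewrite subr0 => nE.
have cpm : cocycle (p + s i m).
  move=> l e; case: l / e.
  by rewrite linearD /= -hom_d -nE.
have [z cz] := proj2 (qs i) _ cpm.
case: i / ij p q n cw e1 e2 e3 cn sn c0 m nE cpm z cz =>
  p q n cw e1 e2 e3 cn sn c0 m nE cpm z cz /(coboundary_down erefl) [w wE].
exists (q - g _ (m - z)).
  move=> l e; case: l / e; rewrite linearB /= -hom_d linearB /= -nE.
  by rewrite cz subr0.
exists j, erefl, ((w, 0), m - z); rewrite hpush_dE -wE linear0.
congr ((_, _), _).
- rewrite [s _ (m - z)]linearB /= [RHS]addrC [RHS]addrA subrK opprD.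
  by rewrite [RHS]addrC subrK sub0r.
- rewrite sub0r; change (q - g _ (m - z) - q = - g _ (m - z)).
  by rewrite [LHS]addrC addKr.
- have -> : mod_d erefl (m - z) = n by rewrite linearB /= cz subr0 nE.
  exact: sub0r.
Qed.

End DGModules.

(* Hom in D(A), as the localization of the homotopy category at the
   quasi-isomorphisms: M -num-> P <-den- N represents den^-1 o num. *)
Record dmor (k : fieldType) (A : dgAlgebra k) (M N : dgModule A) := DMor {
  dmid : dgModule A;
  dnum : dgHom M dmid;
  dden : dgHom N dmid;
  dden_qis : quasi_iso dden
}.

Section DerivedCategory.
Variables (k : fieldType) (A : dgAlgebra k).
Implicit Types M N P Q L X Y : dgModule A.

(* Equality of morphisms in D(A). *)
Definition deq M N (phi psi : dmor M N) : Prop :=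
  exists R (a : dgHom (dmid phi) R) (b : dgHom (dmid psi) R),
  [/\ quasi_iso (hom_comp a (dden phi)),
      homotopic (hom_comp a (dden phi)) (hom_comp b (dden psi)) &
      homotopic (hom_comp a (dnum phi)) (hom_comp b (dnum psi))].

Definition dloc M N (f : dgHom M N) : dmor M N := DMor f (quasi_iso_id N).

Definition did M : dmor M M := dloc (hom_id M).

Definition dzero M N : dmor M N := dloc (hom_zero M N).

(* The middle square commutes up to homotopy, so that
   den^-1 num' den'^-1 num = (inr den)^-1 (inl num). *)
Definition dcomp M N L (psi : dmor N L) (phi : dmor M N) : dmor M L :=
  DMor (hom_comp (hpush_inl (dden phi) (dnum psi)) (dnum phi))
       (quasi_iso_comp (hpush_quasi_iso (dnum psi) (dden_qis phi))
                       (dden_qis psi)).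

(* Both fractions are brought to the common denominator inr den', which is
   homotopic to inl den. *)
Definition dadd M N (phi psi : dmor M N) : dmor M N :=
  DMor (hom_add (hom_comp (hpush_inl (dden phi) (dden psi)) (dnum phi))
                (hom_comp (hpush_inr (dden phi) (dden psi)) (dnum psi)))
       (quasi_iso_comp (hpush_quasi_iso (dden psi) (dden_qis phi))
                       (dden_qis psi)).

Definition dshift (n : int) M N (phi : dmor M N) :
    dmor (shift n M) (shift n N) :=
  DMor (shift_hom n (dnum phi)) (quasi_iso_shift n (dden_qis phi)).

Definition diso M N (phi : dmor M N) : Prop :=
  exists psi : dmor N M,
    deq (dcomp psi phi) (did M) /\ deq (dcomp phi psi) (did N).

Definition disomorphic M N : Prop := exists phi : dmor M N, diso phi.

Definition dzero_object M : Prop := disomorphic M (dgm_zero A).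

(* H(den^-1 num)[x] = [y] iff num x and den y are cohomologous. *)
Definition ghost M N (phi : dmor M N) : Prop :=
  forall (i : int) (x : M i) (y : N i), cocycle x -> cocycle y ->
    cohomologous (dnum phi i x) (dden phi i y) -> coboundary y.

Definition exact_triangle L M N (u : dmor L M) (v : dmor M N)
    (w : dmor N (shift 1 L)) : Prop :=
  exists X Y (f : dgHom X Y)
    (a : dmor L X) (b : dmor M Y) (c : dmor N (cone f)),
  [/\ diso a, diso b, diso c &
    [/\ deq (dcomp b u) (dcomp (dloc f) a),
        deq (dcomp c v) (dcomp (dloc (cone_in f)) b) &
        deq (dcomp (dshift 1 a) w) (dcomp (dloc (cone_out f)) c)]].

(* Index types with decidable equality are classically arbitrary. *)
Definition dcoproduct (I : eqType) (N : I -> dgModule A) C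
    (inj : forall i, dmor (N i) C) : Prop :=
  forall X (g : forall i, dmor (N i) X),
    exists h : dmor C X, (forall i, deq (dcomp h (inj i)) (g i)) /\
      forall h' : dmor C X, (forall i, deq (dcomp h' (inj i)) (g i)) -> deq h' h.

Definition dsum_mor M N (I : Type) (J : seq I) (f : I -> dmor M N) : dmor M N :=
  foldr (fun i phi => dadd (f i) phi) (dzero M N) J.

(* Hom(M, -) preserves all coproducts: the canonical map from the direct sum of
   the Hom(M, N_i) to Hom(M, C) is surjective and injective.  An element of the
   direct sum is a family (f_i) vanishing outside a finite J. *)
Definition compact_object M : Prop :=
  forall (I : eqType) (N : I -> dgModule A) C (inj : forall i, dmor (N i) C),
  dcoproduct inj ->
  (forall phi : dmor M C, exists (J : seq I) (f : forall i, dmor M (N i)),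
     [/\ uniq J, forall i, i \notin J -> deq (f i) (dzero M (N i)) &
         deq (dsum_mor J (fun i => dcomp (inj i) (f i))) phi]) /\
  (forall (J : seq I) (f : forall i, dmor M (N i)),
     uniq J -> (forall i, i \notin J -> deq (f i) (dzero M (N i))) ->
     deq (dsum_mor J (fun i => dcomp (inj i) (f i))) (dzero M C) ->
     forall i, deq (f i) (dzero M (N i))).

Inductive ghost_composite M : nat -> forall N, dmor M N -> Prop :=
| GhostComposite0 : ghost_composite 0 (did M)
| GhostCompositeS n N L (phi : dmor M N) (psi : dmor N L) :
    ghost_composite n phi -> ghost psi ->
    ghost_composite n.+1 (dcomp psi phi).

Definition has_ghost_length M (n : int) : Prop :=
  (dzero_object M /\ n = -1) \/
  exists m : nat, [/\ n = m%:Z,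
    forall N (phi : dmor M N), ghost_composite m.+1 phi ->
      deq phi (dzero M N) &
    exists N (phi : dmor M N), ghost_composite m phi /\
      ~ deq phi (dzero M N)].

(* +oo when no n satisfies [has_ghost_length M n]; such an n is unique. *)
Definition gh_len M : \bar int :=
  xget +oo%E [set n%:E%E | n in has_ghost_length M]%classic.

(* Strictly full subcategories of D(A) are predicates closed under
   isomorphism in D(A). *)
Inductive add_regular : dgModule A -> Prop :=
| AddRegular : add_regular (dgm_regular A)
| AddZero : add_regular (dgm_zero A)
| AddSum X Y : add_regular X -> add_regular Y -> add_regular (dsum X Y)
| AddShift n X : add_regular X -> add_regular (shift n X)
| AddIso X Y : disomorphic X Y -> add_regular X -> add_regular Y.

Inductive smd (C : dgModule A -> Prop) : dgModule A -> Prop :=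
| SmdIn X : C X -> smd C X
| SmdSummand X Y : smd C (dsum X Y) -> smd C X
| SmdIso X Y : disomorphic X Y -> smd C X -> smd C Y.

Definition star (S T : dgModule A -> Prop) M : Prop :=
  exists L N (u : dmor L M) (v : dmor M N) (w : dmor N (shift 1 L)),
    [/\ S L, T N & exact_triangle u v w].

Definition diamond (S T : dgModule A -> Prop) : dgModule A -> Prop :=
  smd (star S T).

Fixpoint thick_level (n : nat) : dgModule A -> Prop :=
  match n with
  | 0%N => dzero_object
  | 1%N => smd add_regular
  | m.+1 => diamond (thick_level m) (smd add_regular)
  end.

Definition level M : \bar int :=
  infimum +oo%E [set n%:Z%:E%E | n in [set n : nat | thick_level n M]]%classic.

End DerivedCategory.

(* Main.v *)
(* A morphism den^-1 num of D(A) vanishes iff its numerator becomes null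
   homotopic after composition with a quasi-isomorphism on either side, and the
   numerator of a composite of n ghosts is a composite of n module maps that are
   zero on cohomology; so everything is done with actual maps and homotopies.

   If M is in <A>_n, then composites of n ghosts out of M vanish: this holds for
   shifts of A, and in an exact triangle L -> M -> N a composite of n ghosts that
   vanishes on L factors through N, where one more ghost kills it.

   Conversely let M be compact.  Let M_{i+1} be the cone of a map F_i -> M_i which
   is onto on cocycles, F_i being a direct sum of shifts of A.  The maps
   M_i -> M_{i+1} are ghosts, so if composites of n ghosts out of M vanish, then so
   does M -> M_n.  A map Z -> M killed by M -> M_n lifts, at M_{n-1}, to F_{n-1}.
   When maps from Z to direct sums of shifts of A factor through finite subsums,
   the lift goes through a finite F', and Z' = fibre (Z -> F') has the same
   property and is killed by M -> M_{n-1}; by induction Z' -> M factors through an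
   object of <A>_{n-1}, and the homotopy pushout of that object with Z along Z'
   is an object of <A>_n through which Z -> M factors.  For the identity of M
   this makes M a direct summand of an object of <A>_n.

   Hence M is in <A>_n iff composites of n ghosts out of M vanish, and both the
   level and the ghost length are determined by the least such n. *)
Require Import Defs.
From HB Require Import structures.
From mathcomp Require Import all_boot all_order all_algebra.
From mathcomp Require Import boolp classical_sets constructive_ereal.

Set Implicit Arguments.
Unset Strict Implicit.
Unset Printing Implicit Defensive.

Import Order.TTheory GRing.Theory Num.Theory.
Local Open Scope ring_scope.

(** * Identities in abelian groups *)

(* Reflection for the tactic [zmod] below.  Rewriting with addrC and addrA is
   unusable on terms whose types contain sums of degrees. *)

Inductive zterm := ZVar of nat | ZZero | ZAdd of zterm & zterm | ZOpp of zterm.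

Fixpoint zcoef (t : zterm) (n : nat) : int :=
  match t with
  | ZVar m => (m == n)%:Z
  | ZZero => 0
  | ZAdd s u => zcoef s n + zcoef u n
  | ZOpp s => - zcoef s n
  end.

Fixpoint zeval (V : zmodType) (env : seq V) (t : zterm) : V :=
  match t with
  | ZVar m => env`_m
  | ZZero => 0
  | ZAdd s u => zeval env s + zeval env u
  | ZOpp s => - zeval env s
  end.

Lemma zevalE (V : zmodType) (env : seq V) t :
  zeval env t = \sum_(i < size env) env`_i *~ zcoef t i.
Proof.
elim: t => [m||s IHs u IHu|s IHs] /=.
- have [mn|mn] := ltnP m (size env).
    rewrite (bigD1 (Ordinal mn)) //= eqxx big1 ?addr0 // => i.
    by rewrite -val_eqE /= eq_sym => /negbTE ->.
  rewrite nth_default // big1 // => i _.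
  by rewrite (gtn_eqF (leq_trans (ltn_ord i) mn)).
- by rewrite big1.
- by rewrite IHs IHu -big_split; apply: eq_bigr => i _; rewrite /= mulrzDr.
- by rewrite IHs -sumrN; apply: eq_bigr => i _; rewrite mulrNz.
Qed.

(** Only the coefficients of the atoms matter, by [zevalE]. The premise is a closed boolean, so
    [zmod] discharges it by computation with [erefl]. *)
Lemma zterm_eq (V : zmodType) (env : seq V) s t :
  all (fun i => zcoef s i == zcoef t i) (iota 0 (size env)) ->
  zeval env s = zeval env t.
Proof.
move=> /allP st; rewrite !zevalE; apply: eq_bigr => i _.
by rewrite (eqP (st i _)) // mem_iota /= add0n ltn_ord.
Qed.

(** Atoms are compared by unification rather than syntactically, since equal elements may occur with
    differently displayed but convertible types. *)
Ltac zindex x env :=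
  lazymatch env with
  | nil => constr:(0%N)
  | cons ?y ?r =>
      match constr:(Set) with
      | _ => let _ := match constr:(Set) with _ => unify x y end in constr:(0%N)
      | _ => let n := zindex x r in constr:(n.+1)
      end
  end.

Ltac zatoms V t env :=
  lazymatch t with
  | (?a + ?b)%R => let env := zatoms V a env in zatoms V b env
  | (- ?a)%R => zatoms V a env
  | 0%R => env
  | _ => constr:(@cons (GRing.Zmodule.sort V) t env)
  end.

Ltac zreify t env :=
  lazymatch t with
  | (?a + ?b)%R =>
      let a := zreify a env in let b := zreify b env in constr:(ZAdd a b)
  | (- ?a)%R => let a := zreify a env in constr:(ZOpp a)
  | 0%R => constr:(ZZero)
  | _ => let n := zindex t env in constr:(ZVar n)
  end.

Ltac zmod :=
  lazymatch goal with
  | |- @eq ?T ?a ?b =>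
      let V := constr:(T : zmodType) in
      let V := match V with (?W : _) => W end in
      let env := zatoms V a (@nil (GRing.Zmodule.sort V)) in
      let env := zatoms V b env in
      let s := zreify a env in
      let t := zreify b env in
      exact (@zterm_eq V env s t erefl)
  end.

Lemma lin0 (R : pzRingType) (U V : lmodType R) (f : U -> V) : linear f -> f 0 = 0.
Proof. by move=> fl; have := fl (- 1) 0 0; rewrite scaler0 addr0 scaleN1r addNr. Qed.

Lemma linD (R : pzRingType) (U V : lmodType R) (f : U -> V) x y :
  linear f -> f (x + y) = f x + f y.
Proof. by move=> fl; have := fl 1 x y; rewrite !scale1r. Qed.

Lemma linN (R : pzRingType) (U V : lmodType R) (f : U -> V) x :
  linear f -> f (- x) = - f x.
Proof. by move=> fl; have := fl (- 1) x 0; rewrite !scaleN1r (lin0 fl) !addr0. Qed.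

Lemma linZ (R : pzRingType) (U V : lmodType R) (f : U -> V) c x :
  linear f -> f (c *: x) = c *: f x.
Proof. by move=> fl; have := fl c x 0; rewrite (lin0 fl) !addr0. Qed.

(** * Homotopies and cohomology *)

Section Homotopy.
Variables (k : fieldType) (A : dgAlgebra k).
Implicit Types M N P Q T X Y Z : dgModule A.

Lemma homD M N (f : dgHom M N) i x y : f i (x + y) = f i x + f i y.
Proof. exact: linearD. Qed.
Lemma homB M N (f : dgHom M N) i x y : f i (x - y) = f i x - f i y.
Proof. exact: linearB. Qed.
Lemma homN M N (f : dgHom M N) i x : f i (- x) = - f i x.
Proof. exact: linearN. Qed.
Lemma hom0 M N (f : dgHom M N) i : f i 0 = 0.
Proof. exact: linear0. Qed.

Lemma dD M i j (e : i + 1 = j) (x y : M i) : mod_d e (x + y) = mod_d e x + mod_d e y.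
Proof. exact: linearD. Qed.
Lemma dB M i j (e : i + 1 = j) (x y : M i) : mod_d e (x - y) = mod_d e x - mod_d e y.
Proof. exact: linearB. Qed.
Lemma dN M i j (e : i + 1 = j) (x : M i) : mod_d e (- x) = - mod_d e x.
Proof. exact: linearN. Qed.
Lemma d0 M i j (e : i + 1 = j) : mod_d e (0 : M i) = 0.
Proof. exact: linear0. Qed.

Lemma actD M i j l (e : i + j = l) (a : A i) (x y : M j) :
  mod_act e a (x + y) = mod_act e a x + mod_act e a y.
Proof. exact: linearD. Qed.
Lemma actN M i j l (e : i + j = l) (a : A i) (x : M j) :
  mod_act e a (- x) = - mod_act e a x.
Proof. exact: linearN. Qed.
Lemma act0 M i j l (e : i + j = l) (a : A i) : mod_act e a (0 : M j) = 0.
Proof. exact: linear0. Qed.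

(** Indexing the components by their target degree removes the equations between degrees; each such
    equation is eliminated once, here, so that later homotopies are plain families. *)
Lemma homotopicI M N (f g : dgHom M N) (h : forall j, M (j + 1) -> N j) :
  (forall j, linear (h j)) ->
  (forall i j (e : i + (j + 1) = i + j + 1) a x,
     h (i + j) (mod_act e a x) = (-1) ^ i *: mod_act erefl a (h j x)) ->
  (forall j x, f (j + 1) x - g (j + 1) x =
     mod_d erefl (h j x) + h (j + 1) (mod_d erefl x)) ->
  homotopic f g.
Proof.
move=> hlin hact hd.
exists (fun i j e x => h j (deg_cast (esym e) x)); split.
- by move=> i j e; case: i / e; exact: hlin.
- move=> i j l j' l' e e' ej el a x.
  case: j / ej e x => e x; case: l' / e' el => el.
  by case: l / el e => e; exact: hact.
- by move=> i j l e1 e2 x; case: l / e2; case: i / e1 x => x; exact: hd.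
Qed.

Lemma homotopicE M N (f g : dgHom M N) : homotopic f g ->
  exists h : forall j, M (j + 1) -> N j,
  [/\ forall j, linear (h j),
      forall i j (e : i + (j + 1) = i + j + 1) a x,
        h (i + j) (mod_act e a x) = (-1) ^ i *: mod_act erefl a (h j x) &
      forall j x, f (j + 1) x - g (j + 1) x =
        mod_d erefl (h j x) + h (j + 1) (mod_d erefl x)].
Proof.
move=> [h [hlin hact hd]]; exists (fun j => h (j + 1) j erefl); split=> //.
Qed.

Lemma homotopic_ext M N (f g : dgHom M N) :
  (forall i x, f i x = g i x) -> homotopic f g.
Proof.
move=> fg; apply: (@homotopicI _ _ _ _ (fun _ _ => 0)).
- by move=> j c x y; rewrite scaler0 addr0.
- by move=> *; rewrite act0 scaler0.
- by move=> j x; rewrite fg subrr d0 addr0.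
Qed.

Lemma homotopic_refl M N (f : dgHom M N) : homotopic f f.
Proof. exact: homotopic_ext. Qed.

Lemma homotopic_sym M N (f g : dgHom M N) : homotopic f g -> homotopic g f.
Proof.
move=> /homotopicE[h [hlin hact hd]].
apply: (@homotopicI _ _ _ _ (fun j x => - h j x)).
- by move=> j c x y; rewrite hlin opprD scalerN.
- by move=> i j e a x; rewrite hact actN scalerN.
- by move=> j x; rewrite -opprB hd dN opprD.
Qed.

Lemma homotopic_trans M N (g f h : dgHom M N) :
  homotopic f g -> homotopic g h -> homotopic f h.
Proof.
move=> /homotopicE[u [ulin uact ud]] /homotopicE[v [vlin vact vd]].
apply: (@homotopicI _ _ _ _ (fun j x => u j x + v j x)).
- by move=> j c x y; rewrite ulin vlin scalerDr addrACA.
- by move=> i j e a x; rewrite uact vact actD scalerDr.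
- by move=> j x; rewrite dD addrACA -ud -vd addrA subrK.
Qed.

Lemma homotopic_compl M N P (g : dgHom N P) (f f' : dgHom M N) :
  homotopic f f' -> homotopic (hom_comp g f) (hom_comp g f').
Proof.
move=> /homotopicE[h [hlin hact hd]].
apply: (@homotopicI _ _ _ _ (fun j x => g j (h j x))).
- by move=> j c x y; rewrite hlin linearP.
- by move=> i j e a x; rewrite hact linearZ /= hom_act.
- by move=> j x; rewrite /= -homB hd homD hom_d.
Qed.

Lemma homotopic_compr M N P (f : dgHom M N) (g g' : dgHom N P) :
  homotopic g g' -> homotopic (hom_comp g f) (hom_comp g' f).
Proof.
move=> /homotopicE[h [hlin hact hd]].
apply: (@homotopicI _ _ _ _ (fun j x => h j (f _ x))).
- by move=> j c x y; rewrite linearP hlin.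
- by move=> i j e a x; rewrite hom_act hact.
- by move=> j x; rewrite /= hd hom_d.
Qed.

Lemma homotopic_add M N (f f' g g' : dgHom M N) :
  homotopic f f' -> homotopic g g' -> homotopic (hom_add f g) (hom_add f' g').
Proof.
move=> /homotopicE[u [ulin uact ud]] /homotopicE[v [vlin vact vd]].
apply: (@homotopicI _ _ _ _ (fun j x => u j x + v j x)).
- by move=> j c x y; rewrite ulin vlin scalerDr addrACA.
- by move=> i j e a x; rewrite uact vact actD scalerDr.
- by move=> j x; rewrite dD addrACA -ud -vd /= opprD addrACA.
Qed.

Lemma homotopic_subr0 M N (f g : dgHom M N) :
  homotopic (hom_add f (hom_opp g)) (hom_zero M N) -> homotopic f g.
Proof.
move=> /homotopic_add /(_ (homotopic_refl g)) fg.
apply: homotopic_trans (homotopic_trans fg _); apply: homotopic_ext => i x /=.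
  by rewrite subrK.
by rewrite add0r.
Qed.

Lemma homotopic_sub0 M N (f g : dgHom M N) :
  homotopic f g -> homotopic (hom_add f (hom_opp g)) (hom_zero M N).
Proof.
move=> /homotopic_add /(_ (homotopic_refl (hom_opp g))) fg.
apply: homotopic_trans fg _.
by apply: homotopic_ext => i x /=; rewrite subrr.
Qed.

Lemma null_compl M N P (g : dgHom N P) (f : dgHom M N) :
  homotopic f (hom_zero M N) -> homotopic (hom_comp g f) (hom_zero M P).
Proof.
move=> /(homotopic_compl g) gf; apply: homotopic_trans gf _.
by apply: homotopic_ext => i x /=; rewrite hom0.
Qed.

Lemma null_compr M N P (g : dgHom N P) (f : dgHom M N) :
  homotopic g (hom_zero N P) -> homotopic (hom_comp g f) (hom_zero M P).
Proof. exact: homotopic_compr. Qed.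

Lemma cocycleE M j (x : M j) : mod_d erefl x = 0 -> cocycle x.
Proof. by move=> dx l e; case: l / e. Qed.

Lemma pred_deg (i : int) : exists j, j + 1 = i.
Proof. by exists (i - 1); rewrite subrK. Qed.

Lemma cocycle0 M i : cocycle (0 : M i).
Proof. by move=> j e; rewrite d0. Qed.
Lemma cocycleD M i (x y : M i) : cocycle x -> cocycle y -> cocycle (x + y).
Proof. by move=> cx cy j e; rewrite dD cx cy addr0. Qed.
Lemma cocycleN M i (x : M i) : cocycle x -> cocycle (- x).
Proof. by move=> cx j e; rewrite dN cx oppr0. Qed.
Lemma cocycleB M i (x y : M i) : cocycle x -> cocycle y -> cocycle (x - y).
Proof. by move=> cx cy; apply: cocycleD => //; apply: cocycleN. Qed.
Lemma coboundary_d M i j (e : i + 1 = j) (x : M i) : coboundary (mod_d e x).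
Proof. by exists i, e, x. Qed.
Lemma coboundary0 M i : coboundary (0 : M i).
Proof. by have [j e] := pred_deg i; exists j, e, 0; rewrite d0. Qed.
Lemma coboundaryN M i (x : M i) : coboundary x -> coboundary (- x).
Proof. by move=> [j [e [u ->]]]; exists j, e, (- u); rewrite dN. Qed.
Lemma cohomologous_refl M i (x : M i) : cohomologous x x.
Proof. by rewrite /cohomologous subrr; apply: coboundary0. Qed.
Lemma cohomologous_sym M i (x y : M i) : cohomologous x y -> cohomologous y x.
Proof. by rewrite /cohomologous -(opprB y); move/coboundaryN; rewrite opprK. Qed.
Lemma cohomologous0 M i (x : M i) : cohomologous x 0 <-> coboundary x.
Proof. by rewrite /cohomologous subr0. Qed.
Lemma cohomologous_cob M i (x y : M i) :
  cohomologous x y -> coboundary x -> coboundary y.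
Proof.
move=> /cohomologous_sym xy /cohomologous0 x0; apply/cohomologous0.
exact: cohomologous_trans xy x0.
Qed.

Lemma homotopic_coh M N (f g : dgHom M N) i (x : M i) :
  homotopic f g -> cocycle x -> cohomologous (f i x) (g i x).
Proof.
move=> /homotopicE[h [hlin _ hd]] cx; have [j e] := pred_deg i.
case: i / e x cx => x cx; exists j, erefl, (h j x).
by rewrite hd cx lin0 ?addr0.
Qed.

Lemma quasi_isoP M N (f : dgHom M N) : quasi_iso f <->
  (forall i (x : M i), cocycle x -> coboundary (f i x) -> coboundary x) /\
  (forall i (y : N i), cocycle y ->
     exists2 x : M i, cocycle x & cohomologous (f i x) y).
Proof.
split=> [qf|[fi fs] i].
  split=> i; last exact: (proj2 (qf i)).
  move=> x cx fx; apply/cohomologous0; apply: (proj1 (qf i)) => //.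
    exact: cocycle0.
  by rewrite hom0; apply/cohomologous0.
split; last exact: fs.
by move=> x y cx cy fxy; apply: fi; [exact: cocycleB | rewrite homB].
Qed.

Lemma quasi_iso_inj M N (f : dgHom M N) i (x : M i) :
  quasi_iso f -> cocycle x -> coboundary (f i x) -> coboundary x.
Proof. by move=> /quasi_isoP[fi _]; apply: fi. Qed.

Lemma quasi_iso_surj M N (f : dgHom M N) i (y : N i) :
  quasi_iso f -> cocycle y -> exists2 x : M i, cocycle x & cohomologous (f i x) y.
Proof. by move=> /quasi_isoP[_ fs]; apply: fs. Qed.

Lemma quasi_iso_htp M N (f g : dgHom M N) :
  homotopic f g -> quasi_iso f -> quasi_iso g.
Proof.
move=> fg /quasi_isoP[fi fs]; apply/quasi_isoP; split=> [i x cx gx|i y cy].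
  apply: fi => //; apply: cohomologous_cob gx; apply: cohomologous_sym.
  exact: homotopic_coh.
have [x cx xy] := fs i y cy; exists x => //.
apply: cohomologous_trans xy; apply: cohomologous_sym.
exact: homotopic_coh.
Qed.

Lemma quasi_iso_compK M N P (g : dgHom N P) (f : dgHom M N) :
  quasi_iso f -> quasi_iso (hom_comp g f) -> quasi_iso g.
Proof.
move=> qf /quasi_isoP[gfi gfs]; apply/quasi_isoP; split=> [i y cy gy|i z cz].
  have [x cx xy] := quasi_iso_surj qf cy.
  apply: (cohomologous_cob xy (hom_coboundary f (gfi _ _ cx _))).
  exact: cohomologous_cob (cohomologous_sym (hom_cohomologous g xy)) gy.
have [x cx xz] := gfs i z cz; exists (f i x) => //.
exact: hom_cocycle.
Qed.

Lemma quasi_iso_Kcomp M N P (g : dgHom N P) (f : dgHom M N) :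
  quasi_iso g -> quasi_iso (hom_comp g f) -> quasi_iso f.
Proof.
move=> qg /quasi_isoP[gfi gfs]; apply/quasi_isoP; split=> [i x cx fx|i y cy].
  by apply: gfi => //; apply: (hom_coboundary g fx).
have [x cx xz] := gfs i (g i y) (hom_cocycle g cy); exists x => //.
rewrite /cohomologous; apply: (quasi_iso_inj qg).
  by apply: cocycleB => //; apply: hom_cocycle.
by rewrite homB.
Qed.

Definition acyclic M := forall i (x : M i), cocycle x -> coboundary x.

Lemma acyclic_quasi_iso M N (f : dgHom M N) :
  acyclic M -> acyclic N -> quasi_iso f.
Proof.
move=> aM aN; apply/quasi_isoP; split=> [i x cx _|i y cy]; first exact: aM.
exists 0; first exact: cocycle0.
by rewrite hom0; apply: cohomologous_sym; apply/cohomologous0; apply: aN.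
Qed.

(* Both say that f vanishes in D(A); see [lnull_rnull]. *)
Definition lnull M N (f : dgHom M N) : Prop :=
  exists T (t : dgHom N T), quasi_iso t /\ homotopic (hom_comp t f) (hom_zero M T).
Definition rnull M N (f : dgHom M N) : Prop :=
  exists T (s : dgHom T M), quasi_iso s /\ homotopic (hom_comp f s) (hom_zero T N).

Definition cohomology_zero M N (f : dgHom M N) : Prop :=
  forall i (x : M i), cocycle x -> coboundary (f i x).

Lemma lnull_zero M N (f : dgHom M N) : homotopic f (hom_zero M N) -> lnull f.
Proof. by move=> f0; exists N, (hom_id N); split=> //; exact: quasi_iso_id. Qed.

Lemma lnull_htp M N (f g : dgHom M N) : homotopic f g -> lnull f -> lnull g.
Proof.
move=> fg [T [t [qt tf]]]; exists T, t; split=> //.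
exact: homotopic_trans (homotopic_compl t (homotopic_sym fg)) tf.
Qed.

Lemma lnull_comp M N P (g : dgHom N P) (f : dgHom M N) :
  lnull g -> lnull (hom_comp g f).
Proof.
move=> [T [t [qt tg]]]; exists T, t; split=> //.
exact: (null_compr f tg).
Qed.

Lemma lnull_qis M N P (g : dgHom N P) (f : dgHom M N) :
  quasi_iso g -> lnull (hom_comp g f) -> lnull f.
Proof.
move=> qg [T [t [qt tg]]]; exists T, (hom_comp t g); split=> //.
exact: quasi_iso_comp.
Qed.

End Homotopy.

(** * Cones and extensions *)

Section Cones.
Variables (k : fieldType) (A : dgAlgebra k).
Implicit Types M N P Q T X Y Z K : dgModule A.

Lemma sign_mulK i : (-1) ^ i * (-1) ^ i = 1 :> k.
Proof. by rewrite -expfzMl mulrNN mulr1 exp1rz. Qed.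

Lemma sign_scaleK (V : lmodType k) i (x : V) : (-1) ^ i *: ((-1) ^ i *: x) = x.
Proof. by rewrite scalerA sign_mulK scale1r. Qed.

Lemma shift1_dE M i (x : M (i + 1)) :
  @mod_d k A (shift 1 M) i (i + 1) erefl x = - mod_d erefl x.
Proof.
by rewrite /= expr1z scaleN1r (eq_irrelevance (addKr_deg 1 erefl) erefl).
Qed.

Lemma shift1_actE M i j (e : i + j = i + j) (e' : i + (j + 1) = i + j + 1) (a : A i)
    (x : M (j + 1)) :
  @mod_act k A (shift 1 M) i j (i + j) e a x = (-1) ^ i *: mod_act e' a x.
Proof. by rewrite /= mul1r (eq_irrelevance (addKl_deg 1 e) e'). Qed.

Lemma cone_dE M N (f : dgHom M N) i (y : N i) (x : M (i + 1)) :
  @mod_d k A (cone f) i (i + 1) erefl (y, x) =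
  (mod_d erefl y + f (i + 1) x, - mod_d erefl x).
Proof. by congr pair; apply: shift1_dE. Qed.

(** Homotopies into a suspension yield maps only in degrees written j + 1. Every degree i is (i - 1)
    + 1, and the transport disappears when i is already a successor. *)
Lemma succ_family (Y K : int -> Type) (h : forall j, Y (j + 1) -> K (j + 1)) :
  exists g : forall i, Y i -> K i, forall j y, g (j + 1) y = h j y.
Proof.
exists (fun i y => ecast i (K i) (subrK 1 i)
  (h (i - 1) (ecast i (Y i) (esym (subrK 1 i)) y))) => j y.
move: (subrK 1 (j + 1)); have -> : j + 1 - 1 = j by rewrite addrK.
by move=> e; rewrite (eq_irrelevance e erefl).
Qed.

Lemma succ_hom M N (h : forall j, M (j + 1) -> N (j + 1)) :
  (forall j, linear (h j)) ->
  (forall i j (e : i + (j + 1) = i + j + 1) a x,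
     h (i + j) (mod_act e a x) = mod_act e a (h j x)) ->
  (forall j x, h (j + 1) (mod_d erefl x) = mod_d erefl (h j x)) ->
  exists f : dgHom M N, forall j x, f (j + 1) x = h j x.
Proof.
move=> hlin hact hd; have [g gE] := @succ_family (fun i => M i) (fun i => N i) h.
have glin i : linear (g i).
  by have [j e] := pred_deg i; case: i / e => c x y; rewrite !gE hlin.
have gact i j l (e : i + j = l) a x : g l (mod_act e a x) = mod_act e a (g j x).
  have [m mE] := pred_deg j; case: j / mE e x => e x.
  have le : l = i + m + 1 by rewrite -e addrA.
  by move: e; rewrite le => e; rewrite !gE hact.
have gd i j (e : i + 1 = j) x : g j (mod_d e x) = mod_d e (g i x).
  have [m mE] := pred_deg i; case: i / mE e x => e x.
  by case: j / e; rewrite !gE hd.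
by exists (DGHom glin gact gd) => j x; apply: gE.
Qed.

(** Mapping property of the cone: the term f x in the differential of (y, x) is matched exactly by
    the null homotopy [h] of b f. *)
Lemma cone_lift_by X Y T (f : dgHom X Y) (b : dgHom Y T)
    (h : forall j, X (j + 1) -> T j) :
  (forall j, linear (h j)) ->
  (forall i j (e : i + (j + 1) = i + j + 1) a x,
     h (i + j) (mod_act e a x) = (-1) ^ i *: mod_act erefl a (h j x)) ->
  (forall j x, b (j + 1) (f (j + 1) x) =
     mod_d erefl (h j x) + h (j + 1) (mod_d erefl x)) ->
  exists u : dgHom (cone f) T, forall i y x, u i (y, x) = b i y + h i x.
Proof.
move=> hlin hact hd.
have ulin i : linear (fun p : cone f i => b i p.1 + h i p.2).
  move=> c [y x] [y' x'] /=; rewrite linearP hlin scalerDr addrACA //.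
have uact i j l (e : i + j = l) a (p : cone f j) :
    b l (mod_act e a p.1) + h l (@mod_act k A (shift 1 X) i j l e a p.2) =
    mod_act e a (b j p.1 + h j p.2).
  case: l / e; rewrite actD hom_act; congr (_ + _).
  have e' : i + (j + 1) = i + j + 1 by rewrite addrA.
  by rewrite (shift1_actE _ e') (linZ _ _ (hlin _)) hact sign_scaleK.
have ud i j (e : i + 1 = j) (p : cone f i) :
    b j (@mod_d k A (cone f) i j e p).1 + h j (@mod_d k A (cone f) i j e p).2 =
    mod_d e (b i p.1 + h i p.2).
  case: j / e; case: p => y x; rewrite cone_dE /= homD hom_d dD -addrA; congr (_ + _).
  by rewrite hd (linN _ (hlin _)) addrK.
by exists (DGHom ulin uact ud).
Qed.

Lemma cone_lift X Y T (f : dgHom X Y) (b : dgHom Y T) :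
  homotopic (hom_comp b f) (hom_zero X T) ->
  exists u : dgHom (cone f) T, forall i y, u i (y, 0) = b i y.
Proof.
move=> /homotopicE[h [hlin hact hd]].
have hd' j x : b (j + 1) (f (j + 1) x) =
    mod_d erefl (h j x) + h (j + 1) (mod_d erefl x) by rewrite -hd /= subr0.
have [u uE] := cone_lift_by hlin hact hd'.
by exists u => i y; rewrite uE (lin0 (hlin _)) addr0.
Qed.

Lemma cone_null X Y (f : dgHom X Y) :
  homotopic (hom_comp (cone_in f) f) (hom_zero X (cone f)).
Proof.
apply: (@homotopicI _ _ _ _ _ _ (fun j x => (0, x) : cone f j)).
- by move=> j c x y; congr pair; rewrite /= ?scaler0 ?addr0.
- move=> i j e a x; congr pair; first by rewrite /= act0 scaler0.
  rewrite /= mul1r sign_scaleK.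
  by rewrite (eq_irrelevance (addKl_deg 1 erefl) e).
- move=> j x; rewrite cone_dE d0 add0r subr0; congr pair; first by rewrite addr0.
  by rewrite addNr.
Qed.

(* The components of a null homotopy of cone_in f o v are a homotopy from v to
   f a and the map a. *)
Lemma cone_colift X Y Z (f : dgHom X Y) (v : dgHom Z Y) :
  homotopic (hom_comp (cone_in f) v) (hom_zero Z (cone f)) ->
  exists a : dgHom Z X, homotopic (hom_comp f a) v.
Proof.
move=> /homotopicE[h [hlin hact hd]].
have [||j x|a aE] := @succ_hom Z X (fun j z => (h j z).2).
- by move=> j c x y; rewrite hlin.
- move=> i j e a x; rewrite hact.
  rewrite /= mul1r sign_scaleK.
  by rewrite (eq_irrelevance (addKl_deg 1 erefl) e).
- have := hd j x; case hE: (h j x) => [y z].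
  rewrite cone_dE => /(congr1 snd) /= e.
  by rewrite (add0_eqN (etrans (esym e) (subr0 0))) opprK.
exists a; apply: homotopic_sym; apply: (@homotopicI _ _ _ _ _ _ (fun j z => (h j z).1)).
- by move=> j c x y; rewrite hlin.
- by move=> i j e b x; rewrite hact.
- move=> j x; have := hd j x; rewrite [hom_comp f a _ x]/= aE; case hE: (h j x) => [y z].
  rewrite cone_dE => /(congr1 fst) /=; rewrite subr0 => ->.
  by rewrite addrAC addrK.
Qed.

End Cones.

(** * Cohomology of cones, fibres and homotopy pushouts *)

Section ConeCohomology.
Variables (k : fieldType) (A : dgAlgebra k).
Implicit Types M N P Q T X Y Z K : dgModule A.

Lemma cone_cocycleP M N (f : dgHom M N) i (y : N i) (x : M (i + 1)) :
  @cocycle k A (cone f) i (y, x) <->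
  mod_d erefl y + f (i + 1) x = 0 /\ cocycle x.
Proof.
split=> [/(_ _ erefl)|[ey cx]].
  rewrite cone_dE => -[ey ex]; split=> //; apply: cocycleE.
  by apply: oppr_inj; rewrite oppr0.
by apply: cocycleE; rewrite cone_dE ey cx oppr0.
Qed.

Lemma cone_coboundaryP M N (f : dgHom M N) i (y : N (i + 1)) (x : M (i + 1 + 1)) :
  @coboundary k A (cone f) (i + 1) (y, x) <->
  exists y' x', y = mod_d erefl y' + f (i + 1) x' /\ x = - mod_d erefl x'.
Proof.
split=> [/(coboundary_down erefl)[[y' x']]|[y' [x' [-> ->]]]].
  by rewrite cone_dE => -[-> ->]; exists y', x'.
by exists i, erefl, (y', x'); rewrite cone_dE.
Qed.

Lemma shift1_cocycleP M i (x : M (i + 1)) :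
  @cocycle k A (shift 1 M) i x <-> @cocycle k A M (i + 1) x.
Proof. exact: shift_cocycle. Qed.

Lemma shift1_coboundaryP M i (x : M (i + 1)) :
  @coboundary k A (shift 1 M) i x <-> @coboundary k A M (i + 1) x.
Proof. exact: shift_coboundary. Qed.

Lemma cone_acyclic M N (f : dgHom M N) : quasi_iso f -> acyclic (cone f).
Proof.
move=> qf i; have [j e] := pred_deg i; case: i / e => -[y x].
move=> /cone_cocycleP[ey cx]; apply/cone_coboundaryP.
have /(coboundary_down erefl)[m xE] : @coboundary k A M _ x.
  apply: (quasi_iso_inj qf) => //.
  by rewrite (add0_eqN ey); apply: coboundaryN; apply: coboundary_d.
have cy : cocycle (y + f _ m).
  by apply: cocycleE; rewrite dD -hom_d -xE.
have [n cn /(coboundary_down erefl)[p pE]] := quasi_iso_surj qf cy.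
(* Here x = d m and y + f m = f n - d p with n a cocycle, so (y, x) is the differential of (- p, n -
   m). *)
exists (- p), (n - m); rewrite dN -pE homB dB cn sub0r opprK; split=> //.
by zmod.
Qed.

Lemma cone_in_quasi_iso M N (f : dgHom M N) : acyclic M -> quasi_iso (cone_in f).
Proof.
move=> aM; apply/quasi_isoP; split=> i; have [j e] := pred_deg i; case: i / e.
  move=> y cy /cone_coboundaryP[y' [x' [-> ex]]].
  have /aM/(coboundary_down erefl)[m ->] : cocycle x'.
    by apply: cocycleE; apply: oppr_inj; rewrite oppr0.
  by rewrite hom_d -dD; apply: coboundary_d.
move=> [y x] /cone_cocycleP[ey cx].
have /(coboundary_down erefl)[m xE] := aM _ _ cx.
exists (y + f _ m); first by apply: cocycleE; rewrite dD -hom_d -xE.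
apply/cone_coboundaryP; exists 0, m; rewrite d0 -xE /=.
by split; zmod.
Qed.

(* The fibre of w.  Writing the target of w as a suspension avoids the degrees
   i + 1 - 1 that a shift by -1 would introduce; see [fib] for the general case. *)
Program Definition ext Z K (w : dgHom Z (shift 1 K)) : dgModule A :=
  @DGModule k A (fun i => (Z i * K i)%type)
    (fun i j l e a p => (mod_act e a p.1, mod_act e a p.2))
    (fun i j e p => (mod_d e p.1, mod_d e p.2 + deg_cast e (w i p.1 : K (i + 1))))
    _ _ _ _ _ _ _.
Next Obligation. by move=> c p q /=; rewrite !linearP. Qed.
Next Obligation. by move=> c a b /=; rewrite !mod_act_lin. Qed.
Next Obligation. by rewrite !mod_act1. Qed.
Next Obligation. by congr pair; apply: mod_actA. Qed.
Next Obligation.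
move=> c p q; congr pair; rewrite /= linearP //.
have := @hom_linear _ _ _ _ w i c p.1 q.1 => /= ->.
by rewrite scalerDr addrACA.
Qed.
Next Obligation.
congr pair; first exact: mod_d_d.
rewrite /= dD mod_d_d add0r hom_d.
by rewrite shift1_dE subrr.
Qed.
Next Obligation.
congr pair; first exact: mod_leibniz.
rewrite /= (mod_leibniz _ erefl erefl _ e1 e2) -[LHS]addrA; congr (_ + _).
rewrite actD scalerDr; congr (_ + _).
rewrite hom_act /= mul1r.
by rewrite (eq_irrelevance (addKl_deg 1 erefl) e2).
Qed.

Lemma ext_dE Z K (w : dgHom Z (shift 1 K)) i (z : Z i) (x : K i) :
  @mod_d k A (ext w) i (i + 1) erefl (z, x) =
  (mod_d erefl z, mod_d erefl x + (w i z : K (i + 1))).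
Proof. by []. Qed.

Lemma ext_cocycleP Z K (w : dgHom Z (shift 1 K)) i (z : Z i) (x : K i) :
  @cocycle k A (ext w) i (z, x) <->
  cocycle z /\ mod_d erefl x + (w i z : K (i + 1)) = 0.
Proof.
split=> [/(_ _ erefl)|[cz ex]].
  by rewrite ext_dE => -[ez ex]; split=> //; apply: cocycleE.
by apply: cocycleE; rewrite ext_dE cz ex.
Qed.

Lemma ext_coboundaryP Z K (w : dgHom Z (shift 1 K)) i (z : Z (i + 1)) (x : K (i + 1)) :
  @coboundary k A (ext w) (i + 1) (z, x) <->
  exists z' x', z = mod_d erefl z' /\ x = mod_d erefl x' + (w i z' : K (i + 1)).
Proof.
split=> [/(coboundary_down erefl)[[z' x']]|[z' [x' [-> ->]]]].
  by rewrite ext_dE => -[-> ->]; exists z', x'.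
by exists i, erefl, (z', x'); rewrite ext_dE.
Qed.

Program Definition ext_out Z K (w : dgHom Z (shift 1 K)) : dgHom (ext w) Z :=
  @DGHom k A (ext w) Z (fun i p => p.1) _ _ _.
Next Obligation. by []. Qed.

Program Definition ext_in Z K (w : dgHom Z (shift 1 K)) : dgHom K (ext w) :=
  @DGHom k A K (ext w) (fun i x => (0, x)) _ _ _.
Next Obligation. by move=> c x y; congr pair; rewrite /= scaler0 addr0. Qed.
Next Obligation. by rewrite act0. Qed.
Next Obligation. by rewrite d0 [w i 0]hom0 addr0. Qed.

Lemma ext_out_quasi_iso Z K (w : dgHom Z (shift 1 K)) :
  acyclic K -> quasi_iso (ext_out w).
Proof.
move=> aK; apply/quasi_isoP; split=> i; last first.
  move=> z cz.
  have /shift1_cocycleP/aK/(coboundary_down erefl)[x xE] := hom_cocycle w cz.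
  exists (z, - x); last exact: cohomologous_refl.
  by apply/ext_cocycleP; split; rewrite // dN -xE addNr.
have [j e] := pred_deg i; case: i / e => -[z x].
move=> /ext_cocycleP[cz ex] /(coboundary_down erefl)[z' /= zE].
apply/ext_coboundaryP.
have /aK/(coboundary_down erefl)[y yE] : cocycle (x - (w j z' : K (j + 1))).
  apply: cocycleE; rewrite dB -ex zE hom_d shift1_dE.
  by [].
by exists z', y; rewrite -yE subrK.
Qed.

Lemma ext_acyclic Z K (w : dgHom Z (shift 1 K)) : quasi_iso w -> acyclic (ext w).
Proof.
move=> qw i; have [j e] := pred_deg i; case: i / e => -[z x].
move=> /ext_cocycleP[cz ex]; apply/ext_coboundaryP.
have /(coboundary_down erefl)[z' zE] : coboundary z.
  apply: (quasi_iso_inj qw) => //; apply/shift1_coboundaryP.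
  by rewrite (add0_eqN ex); apply: coboundaryN; apply: coboundary_d.
have c' : @cocycle k A (shift 1 K) j (x - (w j z' : K (j + 1))).
  apply/shift1_cocycleP; apply: cocycleE; rewrite dB -ex zE hom_d shift1_dE.
  by [].
have [z2 cz2 /shift1_coboundaryP/(coboundary_down erefl)[y yE]] := quasi_iso_surj qw c'.
exists (z' + z2), (- y); rewrite dD cz2 addr0 dN homD; split=> //.
by rewrite -yE; zmod.
Qed.

(** Rotation of the triangle ext w -> Z -> shift 1 K. The map is [w] on Z; on T it is the second
    component of [s], which is a null homotopy of [w] after the projection by the very form of the
    differential of [ext w]. The module T allows the fibre to be replaced along a
    quasi-isomorphism. *)
Lemma cone_ext_out_quasi_iso Z K T (w : dgHom Z (shift 1 K)) (s : dgHom T (ext w)) :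
  quasi_iso s ->
  exists u : dgHom (cone (hom_comp (ext_out w) s)) (shift 1 K), quasi_iso u.
Proof.
move=> qs.
have sd i (t : T i) : (s (i + 1) (mod_d erefl t)).1 = mod_d erefl (s i t).1 /\
    (s (i + 1) (mod_d erefl t)).2 =
    mod_d erefl (s i t).2 + (w i (s i t).1 : K (i + 1)).
  by rewrite hom_d.
have [|||u uE] := @cone_lift_by k A T Z (shift 1 K) (hom_comp (ext_out w) s) w
  (fun j t => (s (j + 1) t).2).
- by move=> j c x y; rewrite linearP.
- move=> i j e a x; rewrite hom_act (shift1_actE _ e) sign_scaleK //.
- by move=> j x; rewrite shift1_dE (proj2 (sd _ _)) addKr.
exists u; apply/quasi_isoP; split=> i; have [j e] := pred_deg i; case: i / e.
  move=> [z t] /cone_cocycleP[ez ct]; rewrite uE /=.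
  move=> /shift1_coboundaryP/(coboundary_down erefl)[b bE].
  have st : - s _ t = @mod_d _ _ (ext w) _ _ erefl (z, - b).
    rewrite ext_dE dN -bE; have /= := add0_eqN ez.
    case: (s _ t) => s1 s2 /= ->; congr pair; first by rewrite /= opprK.
    by rewrite /=; zmod.
  have /(coboundary_down erefl)[t1 t1E] : @coboundary k A T _ t.
    apply: (quasi_iso_inj qs) => //; rewrite -[s _ t]opprK st.
    by apply: coboundaryN; apply: coboundary_d.
  have cy : cocycle ((z, - b) + s _ t1 : ext w _).
    by apply: cocycleE; rewrite dD -st -hom_d -t1E addNr.
  have [t2 ct2 /(coboundary_down erefl)[[z0 b0] y0]] := quasi_iso_surj qs cy.
  have {y0} := congr1 fst y0; rewrite ext_dE /= => y0.
  apply/cone_coboundaryP; exists (- z0), (t2 - t1); split; last first.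
    by rewrite dB ct2 t1E /=; zmod.
  by rewrite dN -y0 homB /=; zmod.
move=> c /shift1_cocycleP cc.
have cy : @cocycle k A (ext w) _ (0, c).
  by apply/ext_cocycleP; split; [exact: cocycle0 | rewrite cc hom0 addr0].
have [t ct /(coboundary_down erefl)[[z0 b0]]] := quasi_iso_surj qs cy.
rewrite ext_dE; case sE: (s _ t) => [s1 s2] [e1 e2].
exists (- z0, t).
  apply/cone_cocycleP; split=> //=; rewrite dN -e1 sE /=; zmod.
rewrite uE /= sE; apply/shift1_coboundaryP; exists (j + 1), erefl, b0.
have -> : mod_d erefl b0 = s2 - c - w _ z0.
  by apply/eqP; rewrite eq_sym subr_eq; apply/eqP; exact: e2.
by rewrite homN /=; zmod.
Qed.

(** The other rotation, K -> ext w -> Z, with the inclusion lifted to T up to homotopy. The map is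
    the first component of [s] on T and the first component of the homotopy on K; both halves are
    diagram chases. *)
Lemma cone_ext_in_quasi_iso Z K T (w : dgHom Z (shift 1 K))
    (s : dgHom T (ext w)) (v : dgHom K T) :
  quasi_iso s -> homotopic (hom_comp s v) (ext_in w) ->
  exists u : dgHom (cone v) Z,
    quasi_iso u /\ forall i t, u i (t, 0) = (s i t).1.
Proof.
move=> qs /homotopicE[h [hlin hact hd]].
have [|||u uE] := @cone_lift_by k A K T Z v (hom_comp (ext_out w) s)
  (fun j t => (h j t).1).
- by move=> j c x y; rewrite hlin.
- by move=> i j e a x; rewrite hact.
- move=> j x /=; have := congr1 fst (hd j x); rewrite /= subr0 => ->.
  by case: (h j x).
exists u; split=> [|i t]; last by rewrite uE /= (lin0 (hlin _)) addr0.
apply/quasi_isoP; split=> i; have [j e] := pred_deg i; case: i / e.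
  move=> [t p] /cone_cocycleP[et cp]; rewrite uE /= => /(coboundary_down erefl)[z zE].
  have hp : s _ (v _ p) - ((0, p) : ext w _) = mod_d erefl (h _ p).
    by have := hd _ p; rewrite cp (lin0 (hlin _)) addr0.
  case yE: (s _ t + h _ p) => [y1 y2].
  have y1E : y1 = mod_d erefl z.
    by rewrite -zE; exact: (esym (congr1 fst yE)).
  have dy : mod_d erefl (s _ t + h _ p) = - (0, p).
    rewrite dD -hp -hom_d (add0_eqN (etrans (addrC _ _) et)) homN; zmod.
  (* Comparing second components in the formula for d (s t + h p), with first component y1 = d z,
     exhibits p as a boundary - d p'. Then t - v p' is a cocycle whose image under [s] bounds, hence
     it is some d t0, and (t, p) = d (t0, p'). *)
  have pE : p = - mod_d erefl (y2 - (w j z : K (j + 1))).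
    have {dy} := congr1 snd dy; rewrite yE ext_dE /= => dy.
    by rewrite -[LHS]opprK -dy y1E dB hom_d shift1_dE.
  set p' := y2 - _ in pE.
  have t'E : cocycle (t - v _ p').
    apply: cocycleE; rewrite dB -hom_d -[mod_d erefl p']opprK -pE homN opprK.
    by rewrite et.
  have /(coboundary_down erefl)[t0 t0E] : coboundary (t - v _ p').
    apply: (quasi_iso_inj qs) => //; rewrite homB.
    have hp' : s _ (v _ p') = (0, p') + mod_d erefl (h _ p') - h _ p.
      have /eqP := hd _ p'; rewrite -[mod_d erefl p']opprK -pE (linN _ (hlin _)).
      by rewrite subr_eq => /eqP e'; apply: etrans e' _; zmod.
    have -> : s _ t - s _ (v _ p') =
        @mod_d _ _ (ext w) _ _ erefl (z, 0) - mod_d erefl (h _ p').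
      rewrite hp'; transitivity ((s _ t + h _ p) - (0, p') - mod_d erefl (h _ p')).
        by zmod.
      congr (_ - _); rewrite yE ext_dE d0 add0r y1E; congr pair; rewrite /= ?subr0 //.
      by rewrite /p'; zmod.
    by rewrite -dB; apply: coboundary_d.
  apply/cone_coboundaryP; exists t0, p'; split=> //.
  by rewrite -t0E subrK.
move=> z cz; have cwz := hom_cocycle w cz; move/shift1_cocycleP in cwz.
set p : K (j + 1 + 1) := w _ z in cwz.
have sv : s _ (v _ p) = mod_d erefl ((z, 0) + h _ p : ext w _).
  have /eqP := hd _ p; rewrite cwz (lin0 (hlin _)) addr0 subr_eq => /eqP e'.
  by apply: etrans e' _; rewrite dD ext_dE cz d0 add0r; zmod.
have /(coboundary_down erefl)[t tE] : coboundary (v _ p).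
  apply: (quasi_iso_inj qs); first exact: hom_cocycle.
  by rewrite sv; apply: coboundary_d.
have cy : cocycle ((z, 0) + h _ p - s _ t : ext w _).
  by apply: cocycleE; rewrite dB -sv -hom_d -tE subrr.
have [t1 ct1 /(coboundary_down erefl)[[z0 b0]]] := quasi_iso_surj qs cy.
move=> /(congr1 fst); rewrite ext_dE /= => e1.
(* With p = w z, [t] bounds v p and makes the pair a cocycle, while [t1] corrects its image under
   [u] to z modulo the boundary of z0. *)
exists (t1 + t, - p).
  apply/cone_cocycleP; split; last exact: cocycleN.
  by rewrite dD ct1 homN -tE add0r subrr.
exists (j), erefl, z0; rewrite -e1 uE /= homD (linN _ (hlin _)).
by case: (s _ t1) (s _ t) (h _ p) => [? ?] [? ?] [? ?] /=; zmod.
Qed.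

Lemma hpush_cocycleE N P Q (s : dgHom N P) (g : dgHom N Q) i (p : P i) (q : Q i)
    (n : N (i + 1)) (x : Q (i + 1)) :
  @cocycle k A (cone (hpush_inr s g)) i (((p, q), n), x) <->
  [/\ mod_d erefl p + s _ n = 0, mod_d erefl q - g _ n + x = 0,
      mod_d erefl n = 0 & mod_d erefl x = 0].
Proof.
split=> [/cone_cocycleP[]|[e1 e2 e3 e4]].
  rewrite hpush_dE => -[e1 e2 e3] cx; split=> //.
  - by rewrite -[RHS]e1; zmod.
  - by apply: oppr_inj; rewrite oppr0 -[RHS]e3; zmod.
apply/cone_cocycleP; rewrite hpush_dE; split; last exact: cocycleE.
by congr ((_, _), _); rewrite /= ?e3 -?[RHS]e1 -?[RHS]e2; zmod.
Qed.

Program Definition cone_hpush_inr N P Q (s : dgHom N P) (g : dgHom N Q) :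
    dgHom (cone (hpush_inr s g)) (cone s) :=
  @DGHom k A (cone (hpush_inr s g)) (cone s) (fun i p => (p.1.1.1, p.1.2)) _ _ _.
Next Obligation. by []. Qed.
Next Obligation.
by rewrite /= !addr0.
Qed.

(** Parallel sides of a homotopy pushout have the same cone: the map is onto and its kernel, the
    part with coordinates in Q, is the cone of the identity of Q, which is acyclic. *)
Lemma cone_hpush_inr_quasi_iso N P Q (s : dgHom N P) (g : dgHom N Q) :
  quasi_iso (cone_hpush_inr s g).
Proof.
apply/quasi_isoP; split=> i; last first.
  move=> [p n] /cone_cocycleP[e1 cn]; exists (((p, 0), n), g _ n).
    by apply/hpush_cocycleE; split; rewrite -?hom_d ?cn ?hom0 // d0 sub0r addNr.
  exact: cohomologous_refl.
have [j e] := pred_deg i; case: i / e => -[[[p q] n] x] /hpush_cocycleE[e1 e2 e3 e4].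
move=> /cone_coboundaryP[p' [n' [pE nE]]].
apply/cone_coboundaryP; exists ((p', 0), n'), (q + g _ n').
rewrite hpush_dE d0 -pE -nE; split.
  congr ((_, _), _); first by rewrite /= addr0.
    by rewrite /=; zmod.
  by rewrite /= addr0.
rewrite dD -hom_d -[mod_d erefl n']opprK -nE homN.
by apply: add0_eqN; exact: e2.
Qed.

(** H(f) is split injective, so the long exact sequence of the cone breaks up and N is P plus the
    cone of f in D(A). This turns retracts into the direct summands used by [smd]. *)
Lemma retract_quasi_iso M N P (f : dgHom M N) (g : dgHom N P) :
  quasi_iso (hom_comp g f) -> quasi_iso (hom_pair g (cone_in f)).
Proof.
move=> qgf; apply/quasi_isoP; split=> i; have [j e] := pred_deg i; case: i / e.
  move=> x cx /(coboundary_down erefl)[[r [y q]]] E.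
  have gx : g _ x = mod_d erefl r := congr1 fst E.
  have {E} := congr1 snd E; rewrite [RHS](cone_dE f y q) => -[xE /esym/eqP]; rewrite oppr_eq0 => /eqP dq.
  have gfq : g _ (f _ q) = mod_d erefl (r - g _ y).
    by rewrite dB -gx xE homD hom_d; zmod.
  have /(coboundary_down erefl)[q' qE] : @coboundary k A M _ q.
    apply: (quasi_iso_inj qgf); first exact: cocycleE.
    by rewrite /= gfq; apply: coboundary_d.
  by rewrite xE qE hom_d -dD; apply: coboundary_d.
move=> [r [y q]] cr.
have [e1 e2] : mod_d erefl r = 0 /\
  @mod_d k A (cone f) _ _ erefl (y, q) = 0.
  by split; [exact: (congr1 fst (cr _ erefl)) | exact: (congr1 snd (cr _ erefl))].
have /cone_cocycleP[dy cq] : @cocycle k A (cone f) _ (y, q) by exact: cocycleE.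
have /(coboundary_down erefl)[q1 q1E] : @coboundary k A M _ q.
  apply: (quasi_iso_inj qgf) => //=.
  have -> : g _ (f _ q) = mod_d erefl (- g _ y).
    by rewrite dN -hom_d (add0_eqN dy) homN.
  exact: coboundary_d.
have cy : cocycle (y + f _ q1) by apply: cocycleE; rewrite dD -hom_d -q1E.
have cr1 : cocycle (r - g _ (y + f _ q1)).
  by apply: cocycleB; [exact: cocycleE | exact: hom_cocycle].
have [q2 cq2 /(coboundary_down erefl)[t tE]] := quasi_iso_surj qgf cr1.
(* The correction by q1, a primitive of q, makes y a cocycle; the cocycle q2 then adjusts its value
   under [g] to r up to a boundary. *)
exists (y + f _ q1 + f _ q2); first by apply: cocycleD => //; exact: hom_cocycle.
exists j, erefl, (t, (0, q1 + q2)); congr pair.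
  by rewrite /= -tE homD /=; zmod.
apply: (etrans _ (esym (cone_dE f 0 (q1 + q2 : M (j + 1))))); rewrite d0 add0r dD cq2 addr0 -q1E.
by congr pair; rewrite /= ?homD; zmod.
Qed.

End ConeCohomology.

(** * Calculus of fractions *)

Section Fractions.
Variables (k : fieldType) (A : dgAlgebra k).
Implicit Types M N P Q T X Y Z K : dgModule A.

Lemma ext_null Z K (w : dgHom Z (shift 1 K)) :
  homotopic (hom_comp w (ext_out w)) (hom_zero (ext w) (shift 1 K)).
Proof.
apply: (@homotopicI _ _ _ _ _ _ (fun j (p : ext w (j + 1)) => p.2 : shift 1 K j)).
- by [].
- by move=> i j e a x; rewrite (shift1_actE _ e) sign_scaleK.
- by move=> j [z x]; rewrite shift1_dE ext_dE /=; zmod.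
Qed.

Lemma ext_lift Y Z K (w : dgHom Z (shift 1 K)) (f : dgHom Y Z) :
  homotopic (hom_comp w f) (hom_zero Y (shift 1 K)) ->
  exists u : dgHom Y (ext w), forall i y, (u i y).1 = f i y.
Proof.
move=> /homotopicE[h [hlin hact hd]].
have [|||u uE] := @succ_hom k A Y (ext w) (fun j y => (f (j + 1) y, h j y : K (j + 1))).
- by move=> j c x y; congr pair; [rewrite linearP | exact: hlin].
- move=> i j e a x; congr pair; first by rewrite hom_act.
  by rewrite hact (shift1_actE _ e) sign_scaleK.
- move=> j y; rewrite ext_dE -hom_d; congr pair.
  have := hd j y; rewrite shift1_dE subr0 /= => ->; zmod.
exists u => i y; have [j e] := pred_deg i; case: i / e y => y.
by rewrite uE.
Qed.

Lemma deg_castD M i j (e : i = j) (x y : M i) :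
  deg_cast e (x + y) = deg_cast e x + deg_cast e y.
Proof. by case: j / e. Qed.

Lemma deg_castZ M i j (e : i = j) c (x : M i) :
  deg_cast e (c *: x) = c *: deg_cast e x.
Proof. by case: j / e. Qed.

Lemma deg_cast_d M i j l m (e1 : i + 1 = j) (e2 : j = l) (e3 : i = m) (e4 : m + 1 = l)
    (x : M i) : deg_cast e2 (mod_d e1 x) = mod_d e4 (deg_cast e3 x).
Proof.
case: l / e2 e4; case: m / e3 => e4.
by rewrite (eq_irrelevance e4 e1).
Qed.

Lemma deg_cast_act M i j l j' l' (e1 : i + j = l) (e2 : l = l') (e3 : j = j')
    (e4 : i + j' = l') (a : A i) (x : M j) :
  deg_cast e2 (mod_act e1 a x) = mod_act e4 a (deg_cast e3 x).
Proof.
case: l' / e2 e4; case: j' / e3 => e4.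
by rewrite (eq_irrelevance e4 e1).
Qed.

Lemma deg_castK M i j (e : i = j) (e' : j = i) (x : M i) : deg_cast e' (deg_cast e x) = x.
Proof. by case: j / e e' => e'; rewrite (eq_irrelevance e' erefl). Qed.


Lemma unshift_deg (i : int) : i = i + 1 + -1. Proof. by rewrite addrK. Qed.

Lemma signK (m n : int) : m + n = 0 -> (-1) ^ m * (-1) ^ n = 1 :> k.
Proof. by move=> mn; rewrite -expfzDr ?oppr_eq0 ?oner_eq0 // mn expr0z. Qed.

Lemma signKl (m n i : int) : m + n = 0 -> (-1) ^ (m * i) * (-1) ^ (n * i) = 1 :> k.
Proof. by move=> mn; apply: signK; rewrite -mulrDl mn mul0r. Qed.

(** Presents any module as a first suspension, the form of target that [ext] requires. The signs of
    the two suspensions cancel, so only a transport of degrees remains. *)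
Program Definition unshift N : dgHom N (shift 1 (shift (-1) N)) :=
  @DGHom k A N (shift 1 (shift (-1) N)) (fun i x => deg_cast (unshift_deg i) x) _ _ _.
Next Obligation. by move=> c x y; rewrite deg_castD deg_castZ. Qed.
Next Obligation.
by rewrite scalerA (signKl _ (subrr 1)) scale1r; apply: deg_cast_act.
Qed.
Next Obligation.
by rewrite scalerA (signK (subrr 1)) scale1r; apply: deg_cast_d.
Qed.

Program Definition reshift N : dgHom (shift 1 (shift (-1) N)) N :=
  @DGHom k A (shift 1 (shift (-1) N)) N
    (fun i x => deg_cast (esym (unshift_deg i)) (x : N (i + 1 + -1))) _ _ _.
Next Obligation. by move=> c x y; rewrite deg_castD deg_castZ. Qed.
Next Obligation.
by rewrite scalerA (signKl _ (subrr 1)) scale1r; apply: deg_cast_act.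
Qed.
Next Obligation.
by rewrite scalerA (signK (subrr 1)) scale1r; apply: deg_cast_d.
Qed.

Lemma unshiftK N i x : reshift N i (unshift N i x) = x.
Proof. exact: deg_castK. Qed.

Lemma unshift_quasi_iso N : quasi_iso (unshift N).
Proof.
have inj i x : unshift N i (reshift N i x) = x.
  exact: (@deg_castK N _ _ (esym (unshift_deg i)) _ x).
apply/quasi_isoP; split=> [i x cx ux|i y cy].
  by rewrite -[x]unshiftK; apply: hom_coboundary.
by exists (reshift N i y); [exact: hom_cocycle | rewrite inj; apply: cohomologous_refl].
Qed.

Definition fib Z N (w : dgHom Z N) : dgModule A := ext (hom_comp (unshift N) w).
Definition fib_out Z N (w : dgHom Z N) : dgHom (fib w) Z :=
  ext_out (hom_comp (unshift N) w).

Lemma fib_null Z N (w : dgHom Z N) :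
  homotopic (hom_comp w (fib_out w)) (hom_zero (fib w) N).
Proof.
have /(null_compl (reshift N)) := @ext_null _ _ (hom_comp (unshift N) w).
apply: homotopic_trans; apply: homotopic_ext => i x.
exact: (esym (unshiftK _)).
Qed.

Lemma fib_lift Y Z N (w : dgHom Z N) (f : dgHom Y Z) :
  homotopic (hom_comp w f) (hom_zero Y N) ->
  exists u : dgHom Y (fib w), forall i y, fib_out w i (u i y) = f i y.
Proof. by move=> /(null_compl (unshift N)) wf; apply: ext_lift. Qed.

Lemma fib_acyclic Z N (w : dgHom Z N) : quasi_iso w -> acyclic (fib w).
Proof.
by move=> qw; apply/ext_acyclic/quasi_iso_comp => //; apply: unshift_quasi_iso.
Qed.

Lemma fib_out_quasi_iso Z N (w : dgHom Z N) : acyclic N -> quasi_iso (fib_out w).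
Proof.
by move=> aN; apply/ext_out_quasi_iso => i x /shift_cocycle/aN/shift_coboundary.
Qed.

(** If t f is null, f lifts to a map u into the fibre of t, which is acyclic; hence the projection
    from the fibre of u is a quasi-isomorphism, and f vanishes on it because u does. The converse is
    dual: f extends over the acyclic cone of s. *)
Lemma lnull_rnull M N (f : dgHom M N) : lnull f <-> rnull f.
Proof.
split=> [[T [t [qt tf]]]|[T [s [qs fs]]]].
  have [u uE] := fib_lift tf; exists (fib u), (fib_out u); split.
    exact/fib_out_quasi_iso/fib_acyclic.
  have /(null_compl (fib_out t)) := fib_null u.
  apply: homotopic_trans; apply: homotopic_ext => i x.
  exact: (esym (uE _ _)).
have [e eE] := cone_lift fs; exists (cone e), (cone_in e); split.
  exact/cone_in_quasi_iso/cone_acyclic.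
have /(null_compr (cone_in s)) := cone_null e.
apply: homotopic_trans; apply: homotopic_ext => i x.
exact: (congr1 (cone_in e i) (esym (eE _ _))).
Qed.

Lemma rnull_comp M N P (g : dgHom N P) (f : dgHom M N) :
  rnull g -> rnull (hom_comp g f).
Proof. by move=> /lnull_rnull g0; apply/lnull_rnull/lnull_comp. Qed.

Lemma hpush_homotopic N P Q (s : dgHom N P) (g : dgHom N Q) :
  homotopic (hom_comp (hpush_inl s g) s) (hom_comp (hpush_inr s g) g).
Proof.
apply: homotopic_subr0; apply: homotopic_trans (cone_null (hom_pair s (hom_opp g))).
apply: homotopic_ext => i x; congr ((_, _), _); rewrite /= ?oppr0 ?addr0 ?add0r //.
Qed.

Program Definition hom_copair P Q T (a : dgHom P T) (b : dgHom Q T) :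
    dgHom (dsum P Q) T :=
  @DGHom k A (dsum P Q) T (fun i p => a i p.1 + b i p.2) _ _ _.
Next Obligation. by move=> c x y; rewrite !linearP scalerDr addrACA. Qed.
Next Obligation. by rewrite actD !hom_act. Qed.
Next Obligation. by rewrite dD !hom_d. Qed.

Lemma hpush_lift N P Q T (s : dgHom N P) (g : dgHom N Q) (a : dgHom P T)
    (b : dgHom Q T) :
  homotopic (hom_comp a s) (hom_comp b g) ->
  exists u : dgHom (hpush s g) T,
    (forall i p, u i (hpush_inl s g i p) = a i p) /\
    (forall i q, u i (hpush_inr s g i q) = b i q).
Proof.
move=> /homotopic_sub0 asbg.
have [|u uE] := @cone_lift k A _ _ _ (hom_pair s (hom_opp g)) (hom_copair a b).
  apply: homotopic_trans asbg; apply: homotopic_ext => i x.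
  by rewrite /= homN.
exists u; split=> i x; first by rewrite /= uE /= hom0 addr0.
by rewrite /= uE /= hom0 add0r.
Qed.

(** Every class of P comes from N, where the left leg agrees with the right leg after [g]. Thus
    moving a ghost past a denominator leaves it a ghost. *)
Lemma hpush_inl_zero N P Q (s : dgHom N P) (g : dgHom N Q) :
  quasi_iso s -> cohomology_zero g -> cohomology_zero (hpush_inl s g).
Proof.
move=> qs g0 i p cp; have [n cn np] := quasi_iso_surj qs cp.
apply: (cohomologous_cob (hom_cohomologous (hpush_inl s g) np)).
have := homotopic_coh (homotopic_sym (hpush_homotopic s g)) cn.
by move=> /cohomologous_cob; apply; exact: (hom_coboundary (hpush_inr s g) (g0 _ _ cn)).
Qed.

End Fractions.

(** * The ghost lemma *)

Section GhostLemma.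
Variables (k : fieldType) (A : dgAlgebra k).
Implicit Types M N P Q T X Y Z K : dgModule A.

(** By two out of three, the map [a] witnessing equality of fractions is a quasi-isomorphism as soon
    as its composite with the denominator is one; conversely a quasi-isomorphism killing the
    numerator gives a common denominator. *)
Lemma deq_zero M N (phi : dmor M N) : deq phi (dzero M N) <-> lnull (dnum phi).
Proof.
split=> [[R [a [b [qa ab abn]]]]|[T [t [qt tn]]]].
  exists R, a; split; first exact: quasi_iso_compK (dden_qis phi) qa.
  apply: homotopic_trans abn _; apply: homotopic_ext => i x /=.
  exact: hom0.
exists T, t, (hom_comp t (dden phi)); split.
- exact: quasi_iso_comp qt (dden_qis phi).
- exact: homotopic_refl.
- apply: homotopic_trans tn _; apply: homotopic_ext => i x /=.
  by rewrite !hom0.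
Qed.

Lemma dcomp_inverse X Y Z (a : dgHom X Y) (qa : quasi_iso a) (b : dgHom Z Y)
  (qb : quasi_iso b) : deq (dcomp (DMor a qb) (DMor b qa)) (did Z).
Proof.
have [u [ul ur]] := @hpush_lift k A _ _ _ Y a a (hom_id Y) (hom_id Y) (homotopic_refl _).
exists Y, u, b; split.
- apply: (quasi_iso_htp _ qb); apply: homotopic_ext => i x.
  exact: (esym (ur _ _)).
- apply: homotopic_ext => i x; exact: (ur _ _).
- apply: homotopic_ext => i x; exact: (ul _ _).
Qed.

Lemma quasi_iso_disomorphic M N P (f : dgHom M P) (g : dgHom N P) :
  quasi_iso f -> quasi_iso g -> disomorphic M N.
Proof.
move=> qf qg; exists (DMor f qg), (DMor g qf).
by split; apply: dcomp_inverse.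
Qed.

Lemma quasi_iso_disom M N (f : dgHom M N) : quasi_iso f -> disomorphic M N.
Proof. by move=> /quasi_iso_disomorphic; apply; apply: quasi_iso_id. Qed.

(** The numerator of an isomorphism is a quasi-isomorphism, by a two-out-of-six argument: the
    composite that is the identity of M makes it injective on cohomology, and the one that is the
    identity of N makes it surjective. *)
Lemma disomorphicP M N : disomorphic M N ->
  exists P (f : dgHom M P) (g : dgHom N P), quasi_iso f /\ quasi_iso g.
Proof.
move=> [phi [psi [[R [a [b [qa ab abn]]]] [R' [a' [b' [qa' ab' abn']]]]]]].
exists (dmid phi), (dnum phi), (dden phi); split; last exact: dden_qis.
apply/quasi_isoP.
have q1 : quasi_iso (hom_comp a (hom_comp (hpush_inl (dden phi) (dnum psi)) (dnum phi))).
  exact: quasi_iso_htp (homotopic_sym abn) (quasi_iso_htp ab qa).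
have q2 : quasi_iso (hom_comp a' (hom_comp (hpush_inl (dden psi) (dnum phi)) (dnum psi))).
  exact: quasi_iso_htp (homotopic_sym abn') (quasi_iso_htp ab' qa').
split=> [i x cx fx|i y cy].
  apply: (quasi_iso_inj q1) => //.
  exact: (hom_coboundary (hom_comp a (hpush_inl (dden phi) (dnum psi))) fx).
set l := hpush_inl (dden psi) (dnum phi) in q2 *.
set r := hpush_inr (dden psi) (dnum phi).
have qr : quasi_iso r by exact: hpush_quasi_iso (dden_qis psi).
have qa2 : quasi_iso a'.
  exact: quasi_iso_compK (quasi_iso_comp qr (dden_qis phi)) qa'.
have q3 := quasi_iso_Kcomp qa2 q2.
have [z cz zy] := quasi_iso_surj q3 (hom_cocycle r cy).
have [x cx xz] := quasi_iso_surj (dden_qis psi) (hom_cocycle (dnum psi) cz).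
exists x => //; rewrite /cohomologous; apply: (quasi_iso_inj qr).
  by apply: cocycleB => //; apply: hom_cocycle.
rewrite homB; apply: cohomologous_trans zy.
apply: cohomologous_trans (hom_cohomologous l xz).
by apply: cohomologous_sym; apply: (homotopic_coh (hpush_homotopic _ _)).
Qed.

Lemma disomorphic_sym M N : disomorphic M N -> disomorphic N M.
Proof. by move=> [phi [psi [e1 e2]]]; exists psi, phi. Qed.

Lemma ghost_num M N (psi : dmor M N) : ghost psi -> cohomology_zero (dnum psi).
Proof.
move=> gpsi i x cx.
have [y cy yx] := quasi_iso_surj (dden_qis psi) (hom_cocycle (dnum psi) cx).
apply: (cohomologous_cob yx); apply: hom_coboundary.
by apply: (gpsi i x y) => //; apply: cohomologous_sym.
Qed.

(* The first of the n ghosts may be preceded by an arbitrary map, which makes the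
   condition stable under precomposition. *)
Fixpoint ghosts (n : nat) M N (h : dgHom M N) : Prop :=
  if n is m.+1 then
    exists P (f : dgHom M P) (g : dgHom P N),
      [/\ ghosts m f, cohomology_zero g & homotopic (hom_comp g f) h]
  else True.

Lemma ghosts_compr n M N P (h : dgHom N P) (f : dgHom M N) :
  ghosts n h -> ghosts n (hom_comp h f).
Proof.
elim: n P h => //= n IHn P h [Q [h0 [g [gh0 g0 gh]]]].
exists Q, (hom_comp h0 f), g; split=> //; first exact: IHn.
exact: homotopic_compr gh.
Qed.

(* Ghosts out of M are transported along M -> M', against the direction in which
   they compose, at the price of enlarging their targets. *)
Lemma ghosts_push n M M' N (s : dgHom M M') (f : dgHom M N) :
  quasi_iso s -> ghosts n f ->
  exists R (f' : dgHom M' R) (t : dgHom N R),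
    [/\ quasi_iso t, ghosts n f' & homotopic (hom_comp f' s) (hom_comp t f)].
Proof.
move=> qs; elim: n N f => [N f _|n IHn N f [P [f0 [g [gf0 g0 gf]]]]].
  exists (hpush s f), (hpush_inl s f), (hpush_inr s f); split=> //.
    exact: hpush_quasi_iso.
  exact: hpush_homotopic.
have [R [f' [t [qt gf' ft]]]] := IHn _ _ gf0.
exists (hpush t g), (hom_comp (hpush_inl t g) f'), (hpush_inr t g); split.
- exact: hpush_quasi_iso.
- exists R, f', (hpush_inl t g); split=> //; last exact: homotopic_refl.
  exact: hpush_inl_zero.
- apply: homotopic_trans (homotopic_compl (hpush_inl t g) ft) _.
  apply: homotopic_trans (homotopic_compl (hpush_inr t g) gf).
  exact: homotopic_compr (hpush_homotopic t g).
Qed.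

Definition kills_ghosts n M := forall N (f : dgHom M N), ghosts n f -> lnull f.

Lemma kills_ghosts_quasi_iso n M M' (s : dgHom M M') :
  quasi_iso s -> (kills_ghosts n M <-> kills_ghosts n M').
Proof.
move=> qs; split=> kM N f gf.
  have /kM/lnull_rnull[T [t [qt tf]]] := ghosts_compr s gf.
  apply/lnull_rnull; exists T, (hom_comp s t); split=> //.
  exact: quasi_iso_comp.
have [R [f' [t [qt gf' ft]]]] := ghosts_push qs gf.
apply: (lnull_qis qt); apply: lnull_htp ft _.
exact/lnull_comp/kM.
Qed.

Lemma kills_ghosts_iso n M N :
  disomorphic M N -> kills_ghosts n M -> kills_ghosts n N.
Proof.
move=> /disomorphicP[P [f [g [qf qg]]]].
by move=> /(kills_ghosts_quasi_iso n qf)/(kills_ghosts_quasi_iso n qg).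
Qed.

Lemma kills_ghosts_summand n M N : kills_ghosts n (dsum M N) -> kills_ghosts n M.
Proof.
move=> kMN P f gf.
have /kMN ln := ghosts_compr (hom_copair (hom_id M) (hom_zero N M)) gf.
apply: lnull_htp (lnull_comp (hom_inl M N) ln); apply: homotopic_ext => i x.
by rewrite /= addr0.
Qed.

Lemma kills_ghosts_smd n (C : dgModule A -> Prop) :
  (forall M, C M -> kills_ghosts n M) -> forall M, smd C M -> kills_ghosts n M.
Proof.
move=> kC M; elim=> {M} [M /kC//|M N _|M N MN _]; first exact: kills_ghosts_summand.
exact: kills_ghosts_iso.
Qed.

(* The composite of the first n ghosts vanishes on X, hence factors through the
   cone, where the last ghost kills it. *)
Lemma kills_ghosts_cone n X Y (u : dgHom X Y) :
  kills_ghosts n X -> kills_ghosts 1 (cone u) -> kills_ghosts n.+1 Y.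
Proof.
move=> kX kC N f [P [f0 [g [gf0 g0 gf]]]].
have [R [t [qt tf0u]]] := kX _ _ (ghosts_compr u gf0).
have [e eE] := @cone_lift k A _ _ _ u (hom_comp t f0) tf0u.
apply: (lnull_qis (hpush_quasi_iso g qt)).
have : lnull (hom_comp (hom_comp (hpush_inl t g) e) (cone_in u)).
  apply/lnull_comp/kC; exists R, e, (hpush_inl t g); split=> //.
    exact: hpush_inl_zero.
  exact: homotopic_refl.
apply: lnull_htp.
apply: homotopic_trans (homotopic_compl (hpush_inr t g) gf).
apply: homotopic_trans (homotopic_compr f0 (hpush_homotopic t g)).
apply: homotopic_ext => i x.
exact: (congr1 (hpush_inl t g i) (eE _ _)).
Qed.

Lemma kills_ghosts_star n (S T : dgModule A -> Prop) :
  (forall M, S M -> kills_ghosts n M) -> (forall M, T M -> kills_ghosts 1 M) ->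
  forall M : dgModule A, star S T M -> kills_ghosts n.+1 M.
Proof.
move=> kS kT M [L [N [u [v [w [/kS kL /kT kN]]]]]].
move=> [X [Y [f [a [b [c [ia ib ic _]]]]]]].
apply: (@kills_ghosts_iso _ Y); first by apply: disomorphic_sym; exists b.
apply: (kills_ghosts_cone (u := f)).
  by apply: kills_ghosts_iso kL; exists a.
by apply: kills_ghosts_iso kN; exists c.
Qed.

End GhostLemma.

(** * Suspensions of A as free modules of rank one, and the ghost lemma *)

Section RankOneFreeModules.
Variables (k : fieldType) (A : dgAlgebra k).
Implicit Types M N P Q T X Y Z K : dgModule A.

(** X is a copy of a suspension of A based at the cocycle e. A property of X, rather than an
    equality with some [shift n], also covers suspensions of suspensions. Linearity of the inverse
    [r] follows from that of the action. *)
Definition free_generator X d (e : X d) : Prop :=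
  cocycle e /\ exists r : forall i j, i + d = j -> X j -> A i,
    (forall i j (E : i + d = j) x, mod_act E (r i j E x) e = x) /\
    (forall i j (E : i + d = j) a, r i j E (mod_act E a e) = a).

Section Generator.
Variables (X : dgModule A) (d : int) (e : X d).
Hypothesis (fe : free_generator e).

Lemma free_generator_ex j x : exists i (E : i + d = j) a, x = mod_act E a e.
Proof.
have [_ [r [re _]]] := fe; exists (j - d), (subrK d j), (r _ _ (subrK d j) x).
by rewrite re.
Qed.

Lemma d_act_cocycle T (t : T d) i j i' j' (E : i + d = j) (ei : i + 1 = i')
    (ej : j + 1 = j') (E' : i' + d = j') (a : A i) :
  cocycle t -> mod_d ej (mod_act E a t) = mod_act E' (alg_d ei a) t.
Proof.
move=> ct; have e2 : i + (d + 1) = j' by rewrite addrA E.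
by rewrite (mod_leibniz E ei erefl ej E' e2) ct act0 scaler0 addr0.
Qed.

(** The degree function [q] allows one construction to serve for chain maps, with q the identity,
    and for homotopies, with q j = j + 1. *)
Lemma free_generator_map (q : int -> int) (V : int -> lmodType k)
    (phi : forall i j, i + d = q j -> A i -> V j) :
  (forall i j (E : i + d = q j), linear (phi i j E)) ->
  exists v : forall j, X (q j) -> V j,
    (forall j, linear (v j)) /\
    forall i j (E : i + d = q j) a, v j (mod_act E a e) = phi i j E a.
Proof.
move=> plin; have [_ [r [re rK]]] := fe.
exists (fun j x => phi _ _ (subrK d (q j)) (r _ _ (subrK d (q j)) x)); split.
  move=> j c x y; rewrite -plin -[in LHS](re _ _ (subrK d (q j)) x).
  by rewrite -[in LHS](re _ _ (subrK d (q j)) y) -mod_act_lin rK.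
move=> i j E a; have iE : q j - d = i by rewrite -E addrK.
move: (subrK d (q j)); rewrite iE => E'; rewrite (eq_irrelevance E' E).
by rewrite rK.
Qed.

Lemma free_generator_hom T (t : T d) :
  cocycle t -> exists v : dgHom X T, v d e = t.
Proof.
move=> ct; have ce := proj1 fe.
have [|v [vlin vE]] := free_generator_map (q := id) (V := T) (phi := fun i j E a => mod_act E a t).
  by move=> i j E; exact: mod_act_linearl.
have vact i j l (E : i + j = l) a x : v l (mod_act E a x) = mod_act E a (v j x).
  have [m [F [b ->]]] := free_generator_ex x.
  have G : i + m + d = l by rewrite -E -F addrA.
  by rewrite vE (mod_actA F E erefl G) vE (mod_actA F E erefl G).
have vd i j (E : i + 1 = j) x : v j (mod_d E x) = mod_d E (v i x).
  have [m [F [b ->]]] := free_generator_ex x.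
  have G : m + 1 + d = j by rewrite -E -F addrAC.
  by rewrite vE (d_act_cocycle F erefl E G b ce) vE (d_act_cocycle F erefl E G b ct).
exists (DGHom vlin vact vd) => /=; have := vE 0 d (add0r d) (alg_one A).
by rewrite !mod_act1.
Qed.

(** If f e - g e = d y, then a e |-> (-1)^|a| a y is a homotopy, by the Leibniz rule and because e
    is a cocycle. *)
Lemma free_generator_homotopic T (f g : dgHom X T) :
  cohomologous (f d e) (g d e) -> homotopic f g.
Proof.
have ce := proj1 fe; have [m dE] := pred_deg d.
move=> /(coboundary_down dE)[y yE].
have degE i j : i + d = j + 1 -> i + m = j.
  by move=> E; apply: (addIr 1); rewrite -E -addrA dE.
have [|h [hlin hE]] := free_generator_map (q := fun j => j + 1) (V := T)
    (phi := fun i j E a => (-1) ^ i *: mod_act (degE i j E) a y).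
  by move=> i j E c a b; rewrite mod_act_lin scalerDr !scalerA mulrC.
apply: (@homotopicI _ _ _ _ _ _ h) => // [i j E a x|j x].
  have [n [F [b ->]]] := free_generator_ex x.
  have G : i + n + d = i + j + 1 by rewrite -addrA F addrA.
  rewrite (mod_actA F E erefl G) !hE linearZ /= scalerA.
  rewrite (mod_actA (degE n j F) erefl erefl (degE (i + n) (i + j) G)).
  by rewrite expfzDr ?oppr_eq0 ?oner_eq0.
have [n [F [b ->]]] := free_generator_ex x.
have G : n + 1 + d = j + 1 + 1 by rewrite -F addrAC.
rewrite (d_act_cocycle F erefl erefl G b ce) !hE linearZ /=.
rewrite (mod_leibniz (degE n j F) erefl dE erefl (degE _ _ G) F) scalerDr sign_scaleK.
rewrite !hom_act -yE actD actN expfzDr ?oppr_eq0 ?oner_eq0 // expr1z mulrN1 scaleNr.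
by zmod.
Qed.

End Generator.
Lemma alg_mul_cast_one i m l (E : i + m = l) (e0 : 0 = m) (e1 : i = l) (a : A i) :
  alg_mul E a (deg_cast e0 (alg_one A : dgm_regular A 0)) =
  deg_cast e1 (a : dgm_regular A i).
Proof.
case: m / e0 E => E; case: l / e1 E => E.
exact: alg_mul1r.
Qed.

(** The Leibniz rule for 1 = 1 * 1 reads d 1 = d 1 + d 1. *)
Lemma alg_d_one j (e : 0 + 1 = j) : alg_d e (alg_one A) = 0.
Proof.
have E : 0 + 1 = 1 :> int by [].
have := @alg_leibniz k A 0 0 0 1 1 1 (addr0 0) E E E (addr0 1) E (alg_one A) (alg_one A).
rewrite alg_mul1r (alg_mul1r (addr0 1)) expr0z scale1r (alg_mul1l E).
move/eqP; rewrite -subr_eq0 opprD addNKr oppr_eq0 => /eqP d1.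
by case: j / e; rewrite (eq_irrelevance erefl E).
Qed.

Definition shift_one n : shift n (dgm_regular A) (- n) :=
  deg_cast (esym (addNr n)) (alg_one A : dgm_regular A 0).

Lemma free_generator_shift_regular n : free_generator (shift_one n).
Proof.
split.
  apply/shift_cocycle; rewrite /shift_one; move: (esym _).
  by move: (- n + n) => m E; case: m / E => j e; exact: (alg_d_one e).
have dE i j : i + - n = j -> j + n = i by move=> <-; rewrite subrK.
exists (fun i j E (x : dgm_regular A (j + n)) => (-1) ^ (n * i) *: deg_cast (dE i j E) x).
have aE i j (E : i - n = j) (a : A i) :
    @mod_act k A (shift n (dgm_regular A)) _ _ _ E a (shift_one n) =
    (-1) ^ (n * i) *: deg_cast (esym (dE i j E)) (a : dgm_regular A i).
  by congr (_ *: _); apply: alg_mul_cast_one.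
split=> i j E x; rewrite aE deg_castZ.
  by rewrite sign_scaleK deg_castK.
by rewrite sign_scaleK deg_castK.
Qed.

Lemma ghosts1_zero M N (f : dgHom M N) : ghosts 1 f -> cohomology_zero f.
Proof.
move=> [P [f0 [g [_ g0 gf]]]] i x cx.
apply: (cohomologous_cob (homotopic_coh gf cx)).
exact: (g0 _ _ (hom_cocycle f0 cx)).
Qed.

(** The two summands are killed after different quasi-isomorphisms [t1] and [t2]; the homotopy
    pushout supplies one quasi-isomorphism factoring through both up to homotopy. *)
Lemma lnull_split X X1 X2 N (f : dgHom X N) (i1 : dgHom X1 X) (i2 : dgHom X2 X)
    (p1 : dgHom X X1) (p2 : dgHom X X2) :
  homotopic (hom_add (hom_comp i1 p1) (hom_comp i2 p2)) (hom_id X) ->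
  lnull (hom_comp f i1) -> lnull (hom_comp f i2) -> lnull f.
Proof.
move=> ip [R1 [t1 [q1 f1]]] [R2 [t2 [q2 f2]]].
exists (hpush t1 t2), (hom_comp (hpush_inr t1 t2) t2); split.
  by apply: quasi_iso_comp => //; apply: hpush_quasi_iso.
set t := hom_comp _ t2.
have tf1 : homotopic (hom_comp t (hom_comp f i1)) (hom_zero _ _).
  apply: homotopic_trans (null_compl (hpush_inl t1 t2) f1).
  exact: homotopic_sym (homotopic_compr (hom_comp f i1) (hpush_homotopic t1 t2)).
have tf2 : homotopic (hom_comp t (hom_comp f i2)) (hom_zero _ _).
  exact: (null_compl (hpush_inr t1 t2) f2).
apply: homotopic_trans (homotopic_compl (hom_comp t f) (homotopic_sym ip)) _.
have tf := homotopic_add (null_compr p1 tf1) (null_compr p2 tf2).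
apply: homotopic_trans (homotopic_trans (homotopic_ext _) tf) (homotopic_ext _).
  by move=> i x; exact: (etrans (congr1 (t i) (homD f _ _)) (homD t _ _)).
by move=> i x; apply: addr0.
Qed.

Lemma bijective_quasi_iso M N (f : dgHom M N) (g : forall i, N i -> M i) :
  (forall i x, g i (f i x) = x) -> (forall i y, f i (g i y) = y) -> quasi_iso f.
Proof.
move=> fK gK; have f_inj i x y : f i x = f i y -> x = y.
  by move=> xy; rewrite -[x]fK xy fK.
apply/quasi_isoP; split=> [i x cx [j [e [y xy]]]|i y cy].
  by exists j, e, (g j y); apply: f_inj; rewrite xy hom_d gK.
exists (g i y); last by rewrite gK; apply: cohomologous_refl.
by move=> j e; apply: f_inj; rewrite hom_d gK cy hom0.
Qed.

Lemma shift_shift_deg (i m n : int) : i + m + n = i + (n + m).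
Proof. by rewrite (addrC n) addrA. Qed.

Program Definition shift_shift m n M : dgHom (shift m (shift n M)) (shift (n + m) M) :=
  @DGHom k A (shift m (shift n M)) (shift (n + m) M)
    (fun i x => @deg_cast k A M _ _ (shift_shift_deg i m n) x) _ _ _.
Next Obligation. by move=> c x y; rewrite -deg_castZ -deg_castD. Qed.
Next Obligation.
rewrite !deg_castZ scalerA -expfzDr ?oppr_eq0 ?oner_eq0 // -mulrDl (addrC m).
by congr (_ *: _); apply: deg_cast_act.
Qed.
Next Obligation.
rewrite !deg_castZ scalerA -expfzDr ?oppr_eq0 ?oner_eq0 // (addrC m).
by congr (_ *: _); apply: deg_cast_d.
Qed.

Lemma shift_shift_quasi_iso m n M : quasi_iso (shift_shift m n M).
Proof.
apply: (@bijective_quasi_iso _ _ (shift_shift m n M) (fun i y =>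
  @deg_cast k A M _ _ (esym (shift_shift_deg i m n)) y)) => i x.
  exact: (@deg_castK k A M).
exact: (@deg_castK k A M).
Qed.

Lemma kills_ghosts1P M :
  (forall N (f : dgHom M N), cohomology_zero f -> lnull f) -> kills_ghosts 1 M.
Proof. by move=> kM N f /ghosts1_zero/kM. Qed.

Lemma kills_ghosts1E M N (f : dgHom M N) :
  kills_ghosts 1 M -> cohomology_zero f -> lnull f.
Proof.
move=> kM f0; apply: kM; exists M, (hom_id M), f; split=> //.
exact: homotopic_refl.
Qed.

(** All suspensions are treated at once so that the induction passes through [AddShift]. For A
    itself, a map that is zero on cohomology sends the generator to a boundary, hence is null
    homotopic. *)
Lemma add_regular_shift_kills_ghosts X : add_regular X -> forall n, kills_ghosts 1 (shift n X).
Proof.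
elim=> {X} [n|n|X Y _ kX _ kY n|m X _ kX n|X Y XY _ kX n].
- apply: kills_ghosts1P => N f f0; apply: lnull_zero.
  have fe := free_generator_shift_regular n.
  apply: (free_generator_homotopic fe).
  by apply/cohomologous0; exact: (f0 _ _ (proj1 fe)).
- apply: kills_ghosts1P => N f _; apply: lnull_zero; apply: homotopic_ext => i x.
  by rewrite (row0_eq x 0); apply: hom0.
- apply: kills_ghosts1P => N f f0.
  apply: (@lnull_split (shift n (dsum X Y)) (shift n X) (shift n Y) N f
    (shift_hom n (hom_inl X Y)) (shift_hom n (hom_inr X Y))
    (shift_hom n (hom_copair (hom_id X) (hom_zero Y X)))
    (shift_hom n (hom_copair (hom_zero X Y) (hom_id Y)))).
  + apply: homotopic_ext => i [x y]; congr pair; rewrite /= ?addr0 ?add0r //.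
  + apply: kills_ghosts1E => // i x cx; apply: f0.
    exact: (hom_cocycle (shift_hom n (hom_inl X Y)) cx).
  + apply: kills_ghosts1E => // i x cx; apply: f0.
    exact: (hom_cocycle (shift_hom n (hom_inr X Y)) cx).
- exact/(kills_ghosts_quasi_iso 1 (shift_shift_quasi_iso n m X)).
- have [P [f [g [qf qg]]]] := disomorphicP XY.
  apply: kills_ghosts_iso (kX n).
  exact: quasi_iso_disomorphic (quasi_iso_shift n qf) (quasi_iso_shift n qg).
Qed.

Lemma add_regular_kills_ghosts X : add_regular X -> kills_ghosts 1 X.
Proof.
move=> aX; apply/(kills_ghosts_quasi_iso 1 (unshift_quasi_iso X)).
by apply: add_regular_shift_kills_ghosts; apply: AddShift.
Qed.

Lemma disomorphic_zero M : disomorphic M (dgm_zero A) -> acyclic M.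
Proof.
move=> /disomorphicP[P [f [g [qf qg]]]] i x cx.
apply: (quasi_iso_inj qf) => //.
have [z _ zx] := quasi_iso_surj qg (hom_cocycle f cx).
apply: (cohomologous_cob zx); rewrite (row0_eq z 0) hom0.
exact: coboundary0.
Qed.

Lemma acyclic_dzero M : acyclic M -> dzero_object M.
Proof.
move=> aM; apply: (quasi_iso_disom (f := hom_zero M (dgm_zero A))).
apply: acyclic_quasi_iso => // i x _; rewrite (row0_eq x 0).
exact: coboundary0.
Qed.

Lemma thick_level_kills_ghosts n M : thick_level n M -> kills_ghosts n M.
Proof.
elim: n M => [M /disomorphic_zero aM N f _|[_ M|n IHn M]].
(* For n = 0 every map out of the acyclic module M has to vanish, which is seen on the
   quasi-isomorphism from the zero module. *)
- apply/lnull_rnull; exists (dgm_zero A), (hom_zero (dgm_zero A) M); split.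
    apply: acyclic_quasi_iso => // i x _; rewrite (row0_eq x 0).
    exact: coboundary0.
  by apply: homotopic_ext => i x; apply: hom0.
- by apply: kills_ghosts_smd => X; apply: add_regular_kills_ghosts.
- apply: kills_ghosts_smd => X; apply: kills_ghosts_star => // Y.
  by apply: kills_ghosts_smd => Z; apply: add_regular_kills_ghosts.
Qed.

Lemma ghost_composite_num n M N (phi : dmor M N) :
  ghost_composite n phi -> ghosts n (dnum phi).
Proof.
elim=> {n N phi} [//|n N L phi psi _ gphi /ghost_num psi0].
exists (dmid phi), (dnum phi), (hpush_inl (dden phi) (dnum psi)); split=> //.
  exact: hpush_inl_zero (dden_qis phi) psi0.
exact: homotopic_refl.
Qed.

Lemma ghost_lemma n M N (phi : dmor M N) :
  thick_level n M -> ghost_composite n phi -> deq phi (dzero M N).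
Proof.
move=> /thick_level_kills_ghosts kM /ghost_composite_num gphi.
exact/deq_zero/kM.
Qed.

End RankOneFreeModules.

(** * Direct sums and compactness *)

Section FiniteSupport.
Variables (k : fieldType) (I : eqType) (V : I -> lmodType k).

(** A finite support is only asserted to exist, so by proof irrelevance elements with the same
    values are equal. *)
Record finsupp := Finsupp {
  fs_fun :> forall i, V i;
  fs_fin : exists s : seq I, forall i, i \notin s -> fs_fun i = 0
}.

Lemma finsuppP (c c' : finsupp) : (forall i, c i = c' i) -> c = c'.
Proof.
case: c c' => [c cf] [c' cf'] /= cc'.
have E : c = c' by apply: functional_extensionality_dep.
by move: cf cf'; rewrite E => cf cf'; rewrite (Prop_irrelevance cf cf').
Qed.

HB.instance Definition _ := gen_eqMixin finsupp.
HB.instance Definition _ := gen_choiceMixin finsupp.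

Program Definition finsupp_zero : finsupp := @Finsupp (fun _ => 0) _.
Next Obligation. by exists [::]. Qed.

Program Definition finsupp_map (f : forall i, V i -> V i) (f0 : forall i, f i 0 = 0)
  (c : finsupp) : finsupp := @Finsupp (fun i => f i (c i)) _.
Next Obligation.
by have [s cs] := fs_fin c; exists s => i /cs ->.
Qed.

Definition finsupp_opp := @finsupp_map (fun i => -%R) (fun i => oppr0 (V i)).
Definition finsupp_scale a := @finsupp_map (fun i => *:%R a) (fun i => scaler0 (V i) a).

Program Definition finsupp_add (c c' : finsupp) : finsupp :=
  @Finsupp (fun i => c i + c' i) _.
Next Obligation.
have [s cs] := fs_fin c; have [s' cs'] := fs_fin c'.
exists (s ++ s') => i; rewrite mem_cat negb_or => /andP[/cs -> /cs' ->].
exact: addr0.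
Qed.

Fact finsupp_addA : associative finsupp_add.
Proof. by move=> a b c; apply: finsuppP => i; apply: addrA. Qed.
Fact finsupp_addC : commutative finsupp_add.
Proof. by move=> a b; apply: finsuppP => i; apply: addrC. Qed.
Fact finsupp_add0 : left_id finsupp_zero finsupp_add.
Proof. by move=> a; apply: finsuppP => i; apply: add0r. Qed.
Fact finsupp_addN : left_inverse finsupp_zero finsupp_opp finsupp_add.
Proof. by move=> a; apply: finsuppP => i; apply: addNr. Qed.

HB.instance Definition _ := GRing.isZmodule.Build finsupp
  finsupp_addA finsupp_addC finsupp_add0 finsupp_addN.

Fact finsupp_scaleA a b c : finsupp_scale a (finsupp_scale b c) = finsupp_scale (a * b) c.
Proof. by apply: finsuppP => i; apply: scalerA. Qed.
Fact finsupp_scale1 : left_id 1 finsupp_scale.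
Proof. by move=> c; apply: finsuppP => i; apply: scale1r. Qed.
Fact finsupp_scaleDr : right_distributive finsupp_scale +%R.
Proof. by move=> a c c'; apply: finsuppP => i; apply: scalerDr. Qed.
Fact finsupp_scaleDl c : {morph finsupp_scale^~ c : a b / a + b}.
Proof. by move=> a b; apply: finsuppP => i; apply: scalerDl. Qed.

HB.instance Definition _ := GRing.Zmodule_isLmodule.Build k finsupp
  finsupp_scaleA finsupp_scale1 finsupp_scaleDr finsupp_scaleDl.

Lemma finsuppDE (c c' : finsupp) i : (c + c') i = c i + c' i. Proof. by []. Qed.
Lemma finsuppZE a (c : finsupp) i : (a *: c) i = a *: c i. Proof. by []. Qed.

Lemma finsupp_support (c : finsupp) :
  exists2 s : seq I, uniq s & forall i, i \notin s -> c i = 0.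
Proof.
have [s cs] := fs_fin c; exists (undup s); first exact: undup_uniq.
by move=> i; rewrite mem_undup; apply: cs.
Qed.

Definition support_of (c : finsupp) : seq I := s2val (cid2 (finsupp_support c)).

Lemma finsupp_sum_eq (W : zmodType) (F : I -> W) s s' :
  uniq s -> uniq s' -> (forall i, i \notin s -> F i = 0) ->
  (forall i, i \notin s' -> F i = 0) -> \sum_(i <- s) F i = \sum_(i <- s') F i.
Proof.
move=> us us' Fs Fs'.
have sumE t : uniq t -> (forall i, i \notin t -> F i = 0) ->
    \sum_(i <- t) F i = \sum_(i <- undup (s ++ s') | F i != 0) F i.
  move=> ut Ft; rewrite (bigID (fun i => F i != 0)) /= [X in _ + X]big1 ?addr0.
    rewrite -big_filter -[RHS]big_filter; apply: perm_big.
    apply: uniq_perm; rewrite ?filter_uniq ?undup_uniq // => i.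
    rewrite !mem_filter mem_undup mem_cat; case: (eqVneq (F i) 0) => //= Fi.
    have -> : i \in s by apply: contraNT (Fi) => /Fs ->.
    by apply: contraNT (Fi) => /Ft ->.
  by move=> i; rewrite negbK => /eqP.
by rewrite !sumE.
Qed.

Section Sum.
Variable (W : lmodType k).
Implicit Type F : forall i, V i -> W.

(** The support is an arbitrary choice; by [fsumE] any other one gives the same sum when each F i
    vanishes at 0. *)
Definition fsum F (c : finsupp) : W := \sum_(i <- support_of c) F i (c i).

Lemma fsumE F (c : finsupp) s : (forall i, F i 0 = 0) -> uniq s ->
  (forall i, i \notin s -> c i = 0) -> fsum F c = \sum_(i <- s) F i (c i).
Proof.
move=> F0 us cs; rewrite /fsum /support_of; case: cid2 => t ut ct /=.
by apply: finsupp_sum_eq => // i => [/ct ->|/cs ->].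
Qed.

Lemma fsum_linear F : (forall i, linear (F i)) -> linear (fsum F).
Proof.
move=> Flin a c c'; have F0 i : F i 0 = 0 by apply: lin0 (Flin i).
have [s us cs] := finsupp_support c; have [s' us' cs'] := finsupp_support c'.
have ut := undup_uniq (s ++ s').
have ct i : i \notin undup (s ++ s') -> c i = 0.
  by rewrite mem_undup mem_cat negb_or => /andP[/cs].
have ct' i : i \notin undup (s ++ s') -> c' i = 0.
  by rewrite mem_undup mem_cat negb_or => /andP[_ /cs'].
rewrite !(fsumE F0 ut) // => [|i it].
  by rewrite scaler_sumr -big_split; apply: eq_bigr => i _; apply: Flin.
by rewrite finsuppDE finsuppZE ct // ct' // scaler0 addr0.
Qed.

Lemma eq_fsum F F' (c : finsupp) : (forall i, F i (c i) = F' i (c i)) -> fsum F c = fsum F' c.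
Proof. by move=> FF'; apply: eq_bigr => i _. Qed.

Lemma fsum_add F F' c : fsum (fun i x => F i x + F' i x) c = fsum F c + fsum F' c.
Proof. exact: big_split. Qed.

End Sum.

Lemma fsum_morph (W W' : lmodType k) (phi : W -> W') (F : forall i, V i -> W) c :
  linear phi -> phi (fsum F c) = fsum (fun i x => phi (F i x)) c.
Proof.
move=> philin; apply: (big_morph phi _ (lin0 philin)) => x y.
exact: linD philin.
Qed.

Program Definition finsupp_in i (x : V i) : finsupp :=
  @Finsupp (dfwith (fun n => 0 : V n) x) _.
Next Obligation.
by exists [:: i] => j; rewrite inE eq_sym => ij; rewrite dfwith_out.
Qed.

Lemma finsupp_inE i x : finsupp_in x i = x.
Proof. exact: dfwith_in. Qed.

Lemma finsupp_in_out i j (x : V i) : i != j -> finsupp_in x j = 0.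
Proof. exact: dfwith_out. Qed.

Lemma finsupp_in_linear i : linear (@finsupp_in i).
Proof.
move=> a x y; apply: finsuppP => j; rewrite finsuppDE finsuppZE.
have [<-|ij] := eqVneq i j; first by rewrite !finsupp_inE.
by rewrite !finsupp_in_out // scaler0 addr0.
Qed.

Lemma fsum_in (W : lmodType k) (F : forall i, V i -> W) i x :
  (forall i, F i 0 = 0) -> fsum F (@finsupp_in i x) = F i x.
Proof.
move=> F0; rewrite (@fsumE _ _ _ [:: i]) ?big_seq1 ?finsupp_inE // => j.
by rewrite inE eq_sym => ij; rewrite finsupp_in_out.
Qed.

Lemma finsupp_decomp (c : finsupp) : c = fsum finsupp_in c.
Proof.
apply: finsuppP => j; pose ev (c : finsupp) := c j.
have evl : linear ev by [].
rewrite -[RHS]/(ev _) (fsum_morph _ _ evl).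
have F0 i : ev (finsupp_in (0 : V i)) = 0.
  by rewrite (lin0 (@finsupp_in_linear i)).
have [s us cs] := finsupp_support c.
have [js|/[dup] js /cs cj] := boolP (j \in s); last first.
  rewrite cj (fsumE F0 us cs) big1_seq // => i /andP[_ si].
  by rewrite /ev finsupp_in_out //; apply: contraNneq js => <-.
rewrite (fsumE F0 us cs) (bigD1_seq j) //= big1 ?addr0 => [|i ij].
  by rewrite /ev /= dfwith_in.
by rewrite /ev /= dfwith_out.
Qed.

End FiniteSupport.

Lemma fsum_map (k : fieldType) (I : eqType) (V V' : I -> lmodType k) (W : lmodType k)
    (F : forall i, V' i -> W) (f : forall i, V i -> V' i) (c : finsupp V) (c' : finsupp V') :
  (forall i, F i 0 = 0) -> (forall i, f i 0 = 0) ->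
  (forall i, c' i = f i (c i)) -> fsum F c' = fsum (fun i x => F i (f i x)) c.
Proof.
move=> F0 f0 c'E; have [s us cs] := finsupp_support c.
rewrite (fsumE F0 us) => [|i /cs ci]; last by rewrite c'E ci f0.
rewrite (fsumE _ us cs) => [|i]; last by rewrite f0.
by apply: eq_bigr => i _; rewrite c'E.
Qed.

(** * Direct sums of DG modules *)

Section DirectSum.
Variables (k : fieldType) (A : dgAlgebra k).
Variables (I : eqType) (N : I -> dgModule A).

Program Definition bigsum_map i j (f : forall n, N n i -> N n j) (f0 : forall n, f n 0 = 0)
   (c : finsupp (fun n => N n i)) : finsupp (fun n => N n j) :=
   @Finsupp k I (fun n => N n j) (fun n => f n (c n)) _.
Next Obligation. by have [s cs] := fs_fin c; exists s => n /cs ->. Qed.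

Program Definition bigsum : dgModule A :=
  @DGModule k A (fun j => finsupp (fun n => N n j))
    (fun i j l e a => bigsum_map (f := fun n => mod_act e a) (fun n => act0 (N n) e a))
    (fun i j e => bigsum_map (f := fun n => mod_d e) (fun n => d0 (N n) e)) _ _ _ _ _ _ _.
Next Obligation. by move=> a' c c'; apply: finsuppP => n; apply: mod_act_linearr. Qed.
Next Obligation. by move=> c a b; apply: finsuppP => n; apply: mod_act_linearl. Qed.
Next Obligation. by apply: finsuppP => n; apply: mod_act1. Qed.
Next Obligation. by apply: finsuppP => n; apply: mod_actA. Qed.
Next Obligation. by move=> a' c c'; apply: finsuppP => n; apply: mod_d_linear. Qed.
Next Obligation. by apply: finsuppP => n; apply: mod_d_d. Qed.
Next Obligation. by apply: finsuppP => n; apply: mod_leibniz. Qed.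

Program Definition bigsum_in n : dgHom (N n) bigsum :=
  @DGHom k A (N n) bigsum
    (fun j x => @finsupp_in k I (fun n => N n j) n x) _ _ _.
Next Obligation. by move=> c x y; apply: finsupp_in_linear. Qed.
Next Obligation.
apply: finsuppP => m; rewrite /bigsum_map /=.
have [<-|nm] := eqVneq n m; first by rewrite !dfwith_in.
by rewrite !dfwith_out // act0.
Qed.
Next Obligation.
apply: finsuppP => m; rewrite /bigsum_map /=.
have [<-|nm] := eqVneq n m; first by rewrite !dfwith_in.
by rewrite !dfwith_out // d0.
Qed.

Lemma bigsum_hom T (v : forall n, dgHom (N n) T) :
  exists u : dgHom bigsum T, forall n i x, u i (bigsum_in n i x) = v n i x.
Proof.
pose u i (c : bigsum i) : T i := fsum (fun n => v n i) c.
have v0 i n : v n i 0 = 0 := hom0 (v n) i.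
have ulin i : linear (u i) by apply: fsum_linear => n; apply: hom_linear.
have uact i j l (e : i + j = l) a x : u l (mod_act e a x) = mod_act e a (u j x).
  rewrite /u (fsum_morph _ _ (@mod_act_linearr k A T i j l e a)).
  rewrite (@fsum_map _ _ _ _ _ (fun n => v n l) (fun n => mod_act e a) x) //.
    by apply: eq_fsum => n; rewrite hom_act.
  by move=> n; rewrite act0.
have ud i j (e : i + 1 = j) x : u j (mod_d e x) = mod_d e (u i x).
  rewrite /u (fsum_morph _ _ (@mod_d_linear k A T i j e)).
  rewrite (@fsum_map _ _ _ _ _ (fun n => v n j) (fun n => mod_d e) x) //.
    by apply: eq_fsum => n; rewrite hom_d.
  by move=> n; rewrite d0.
by exists (DGHom ulin uact ud) => n i x /=; rewrite /u fsum_in.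
Qed.

(** Homotopies chosen on the summands are added up over the finite support of each element. *)
Lemma bigsum_homotopic T (f g : dgHom bigsum T) :
  (forall n, homotopic (hom_comp f (bigsum_in n)) (hom_comp g (bigsum_in n))) ->
  homotopic f g.
Proof.
move=> fg; have {fg} fg n := homotopicE (fg n).
pose h n := sval (cid (fg n)); have hP n := svalP (cid (fg n)); rewrite -/(h _) in hP.
pose u j (c : bigsum (j + 1)) : T j := fsum (fun n => h n j) c.
have h0 n j : h n j 0 = 0 by apply: lin0; case: (hP n).
apply: (@homotopicI _ _ _ _ _ _ u) => [j|i j e a x|j x].
- by apply: fsum_linear => n; case: (hP n).
- rewrite /u (@fsum_map _ _ _ _ _ (fun n => h n (i + j)) (fun n => mod_act e a) x) //.
    have plin : linear (fun t : T j => (-1) ^ i *: mod_act erefl a t : T (i + j)).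
      by move=> c t t'; rewrite linearP scalerDr !scalerA mulrC.
    rewrite [RHS](fsum_morph _ _ plin); apply: eq_fsum => n.
    by case: (hP n) => _ + _; apply.
  by move=> n; rewrite act0.
- have plin : linear (fun c => f (j + 1) c - g (j + 1) c).
    by move=> c t t'; rewrite (hom_linear f) (hom_linear g) scalerBr; zmod.
  rewrite [in LHS](finsupp_decomp x) [LHS](fsum_morph _ _ plin).
  have -> : mod_d erefl (u j x) = fsum (fun n y => mod_d erefl (h n j y)) x.
    by rewrite /u (fsum_morph _ _ (@mod_d_linear k A T j _ erefl)).
  have -> : u (j + 1) (mod_d erefl x) = fsum (fun n y => h n (j + 1) (mod_d erefl y)) x.
    rewrite /u; apply: fsum_map => // n; exact: d0.
  rewrite -fsum_add; apply: eq_fsum => n.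
  by case: (hP n) => _ _; apply.
Qed.

End DirectSum.

(** * Direct sums of suspensions of A, and maps to them from compact objects *)

Section FreeModules.
Variables (k : fieldType) (A : dgAlgebra k).
Implicit Types M P Q T X Y Z K : dgModule A.

Lemma rnull_htp M N (f g : @dgHom k A M N) : homotopic f g -> rnull f -> rnull g.
Proof. by move=> fg /lnull_rnull/(lnull_htp fg)/lnull_rnull. Qed.

Lemma rnull_compl M N P (g : dgHom N P) (f : @dgHom k A M N) :
  rnull f -> rnull (hom_comp g f).
Proof. by move=> [T [s [qs fs]]]; exists T, s; split=> //; exact: (null_compl g fs). Qed.

Section Family.
Variables (I : eqType) (n : I -> int).

Definition free_module : dgModule A := bigsum (fun i => shift (n i) (dgm_regular A)).

Definition free_in i : dgHom (shift (n i) (dgm_regular A)) free_module :=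
  bigsum_in (fun i => shift (n i) (dgm_regular A)) i.

Definition free_gen i : free_module (- n i) := free_in i _ (shift_one A (n i)).

Lemma free_gen_cocycle i : cocycle (free_gen i).
Proof. exact: (hom_cocycle (free_in i) (proj1 (free_generator_shift_regular A (n i)))). Qed.

Lemma free_module_hom T (t : forall i, T (- n i)) :
  (forall i, cocycle (t i)) -> exists v : dgHom free_module T,
    forall i, v _ (free_gen i) = t i.
Proof.
move=> ct; have fg i := free_generator_hom (free_generator_shift_regular A (n i)) (ct i).
have [v vE] := bigsum_hom (fun i => sval (cid (fg i))).
by exists v => i; rewrite /free_gen vE; exact: (svalP (cid (fg i))).
Qed.

Lemma free_module_homotopic T (f g : dgHom free_module T) :
  (forall i, cohomologous (f _ (free_gen i)) (g _ (free_gen i))) -> homotopic f g.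
Proof.
move=> fg; apply: bigsum_homotopic => i.
by apply: (free_generator_homotopic (free_generator_shift_regular A (n i))); apply: fg.
Qed.

(** A fraction out of a suspension of A is determined by a cohomology class of X, represented by a
    cocycle [x i]. Freeness gives an actual map with these values. For uniqueness, two candidates
    are compared on the generators, where cohomologous values suffice for a homotopy. *)
Lemma free_module_coproduct : dcoproduct (fun i => dloc (free_in i)).
Proof.
move=> X g.
have gi i : exists x : X (- n i), cocycle x /\
    cohomologous (dden (g i) _ x) (dnum (g i) _ (shift_one A (n i))).
  have [x cx xE] := quasi_iso_surj (dden_qis (g i))
    (hom_cocycle (dnum (g i)) (proj1 (free_generator_shift_regular A (n i)))).
  by exists x.
pose x i := sval (cid (gi i)).
have cx i : cocycle (x i) := proj1 (svalP (cid (gi i))).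
have xE i : cohomologous (dden (g i) _ (x i)) (dnum (g i) _ (shift_one A (n i))) :=
  proj2 (svalP (cid (gi i))).
have [h hE] := free_module_hom cx.
exists (dloc h); split=> [i|h' hh'].
  have [u [ul ur]] := @hpush_lift k A _ _ _ _ (hom_id free_module) h
    (hom_comp (dden (g i)) h) (dden (g i)) (homotopic_refl _).
  exists (dmid (g i)), u, (hom_id _); split.
  - apply: (quasi_iso_htp _ (dden_qis (g i))); apply: homotopic_ext => j y.
    exact: (esym (ur _ _)).
  - apply: homotopic_ext => j y; exact: (ur _ _).
  - apply: (homotopic_trans (g := hom_comp (dden (g i)) (hom_comp h (free_in i)))).
      by apply: homotopic_ext => j y; exact: (ul _ _).
    apply: (free_generator_homotopic (free_generator_shift_regular A (n i))).
    by have := xE i; rewrite -hE.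
exists (dmid h'), (hom_id _), (dden h'); split.
- exact: (dden_qis h').
- exact: homotopic_refl.
apply: free_module_homotopic => i; rewrite [hom_comp (dden h') _ _ _]/= hE.
have [R [a [b [qa ab abn]]]] := hh' i.
have qar : quasi_iso (hom_comp a (hpush_inr (hom_id free_module) (dnum h'))).
  exact: (quasi_iso_compK (dden_qis h')).
rewrite /cohomologous; apply: (quasi_iso_inj qar).
  by apply: cocycleB; apply: hom_cocycle; [exact: free_gen_cocycle | exact: cx].
rewrite homB.
have e1 := homotopic_coh (homotopic_compl a (hpush_homotopic (hom_id free_module) (dnum h')))
  (free_gen_cocycle (i := i)).
have e2 := homotopic_coh abn (proj1 (free_generator_shift_regular A (n i))).
have e3 := homotopic_coh ab (cx i).
apply: cohomologous_trans (cohomologous_sym e1) _.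
apply: cohomologous_trans e2 _; apply: cohomologous_trans (cohomologous_sym e3).
exact: (cohomologous_sym (hom_cohomologous b (xE i))).
Qed.

End Family.

(* [q o phi = 0] in D(A). *)
Definition dkills M N P (q : dgHom N P) (phi : dmor M N) : Prop :=
  exists R (t : dgHom (dmid phi) R) (q' : dgHom P R),
    [/\ quasi_iso q', homotopic (hom_comp t (dden phi)) (hom_comp q' q) &
        homotopic (hom_comp t (dnum phi)) (hom_zero M R)].

Lemma dkills_deq M N P (q : dgHom N P) (phi psi : dmor M N) :
  deq phi psi -> dkills q phi -> dkills q psi.
Proof.
move=> [T [a [b [qa ab abn]]]] [R [t [q' [qq' tq tn]]]].
have qa' : quasi_iso a by exact: (quasi_iso_compK (dden_qis phi) qa).
exists (hpush a t), (hom_comp (hpush_inl a t) b), (hom_comp (hpush_inr a t) q'); split.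
- exact: (quasi_iso_comp (hpush_quasi_iso t qa') qq').
- apply: homotopic_trans (homotopic_compl (hpush_inl a t) (homotopic_sym ab)) _.
  apply: homotopic_trans (homotopic_compr (dden phi) (hpush_homotopic a t)) _.
  exact: (homotopic_compl (hpush_inr a t) tq).
- apply: homotopic_trans (homotopic_compl (hpush_inl a t) (homotopic_sym abn)) _.
  apply: homotopic_trans (homotopic_compr (dnum phi) (hpush_homotopic a t)) _.
  exact: (null_compl (hpush_inr a t) tn).
Qed.

Lemma dkills_zero M N P (q : dgHom N P) : dkills q (dzero M N).
Proof.
exists P, q, (hom_id P); split.
- exact: quasi_iso_id.
- exact: homotopic_refl.
- by apply: homotopic_ext => i x; apply: hom0.
Qed.

Lemma dkills_add M N P (q : dgHom N P) (phi psi : dmor M N) :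
  dkills q phi -> dkills q psi -> dkills q (dadd phi psi).
Proof.
move=> [R1 [t1 [q1 [qq1 tq1 tn1]]]] [R2 [t2 [q2 [qq2 tq2 tn2]]]].
set l := hpush_inl q1 q2; set r := hpush_inr q1 q2.
have lr : homotopic (hom_comp (hom_comp l t1) (dden phi))
    (hom_comp (hom_comp r t2) (dden psi)).
  apply: homotopic_trans (homotopic_compl l tq1) _.
  apply: homotopic_trans (homotopic_compr q (hpush_homotopic q1 q2)) _.
  exact: (homotopic_compl r (homotopic_sym tq2)).
have [u [ul ur]] := hpush_lift lr.
exists (hpush q1 q2), u, (hom_comp r q2); split.
- by apply: quasi_iso_comp => //; apply: hpush_quasi_iso.
- apply: homotopic_trans (homotopic_compl r tq2).
  by apply: homotopic_ext => i x; exact: (ur _ _).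
- have tf := homotopic_add (null_compl l tn1) (null_compl r tn2).
  apply: homotopic_trans (homotopic_trans (homotopic_ext _) tf) (homotopic_ext _).
    move=> i x; apply: (etrans (homD u _ _)).
    exact: (congr2 +%R (ul _ _) (ur _ _)).
  by move=> i x; apply: addr0.
Qed.

Lemma dkills_dloc_comp M L N P (q : dgHom N P) (g : dgHom L N) (f : dmor M L) :
  (forall i x, q i (g i x) = 0) -> dkills q (dcomp (dloc g) f).
Proof.
move=> qg.
have [|u [ul ur]] := @hpush_lift k A _ _ _ _ (dden f) g (hom_zero _ P) q.
  by apply: homotopic_ext => i x; rewrite /= qg.
exists P, u, (hom_id P); split.
- exact: quasi_iso_id.
- by apply: homotopic_ext => i x; exact: (ur _ _).
- by apply: homotopic_ext => i x; exact: (ul _ _).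
Qed.

(** The projection onto the complement of the subsum on [J]: when its composite with a map vanishes,
    that map factors through the finite subsum, by [finite_incl_proj]. *)
Program Definition trunc (I : eqType) (n : I -> int) (J : seq I) :
    dgHom (free_module n) (free_module n) :=
  @DGHom k A (free_module n) (free_module n)
   (fun j => bigsum_map (f := fun i x => if i \in J then 0 else x) _) _ _ _.
Next Obligation. by case: ifP. Qed.
Next Obligation.
move=> c x y; apply: finsuppP => m; rewrite finsuppDE finsuppZE /=.
by case: ifP; rewrite ?scaler0 ?addr0.
Qed.
Next Obligation.
apply: finsuppP => m /=; case: ifP => // _.
exact: (esym (@act0 k A (shift (n m) (dgm_regular A)) _ _ _ erefl a)).
Qed.
Next Obligation.
apply: finsuppP => m /=; case: ifP => // _.
exact: (esym (@d0 k A (shift (n m) (dgm_regular A)) _ _ erefl)).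
Qed.

(* Maps in D(A) from Z to a direct sum of shifts of A factor through finite
   subsums, right fractions being used for the morphisms. *)
Definition finite_factor Z := forall Z' (s : dgHom Z' Z), quasi_iso s ->
  forall (I : eqType) (n : I -> int) (w : dgHom Z' (free_module n)),
  exists J : seq I, uniq J /\ rnull (hom_comp (trunc n J) w).

(** The right fraction w s^-1 is rewritten as a left fraction through the homotopy pushout.
    Compactness expresses it as a finite sum of morphisms through the summands with index in [J],
    and each of these is killed by the truncation at [J]. *)
Lemma compact_finite_factor M : compact_object M -> finite_factor M.
Proof.
move=> cM M' s qs I n w.
have [sur _] := cM _ _ _ _ (@free_module_coproduct I n).
have [J [f [uJ _ fw]]] := sur (DMor (hpush_inl s w) (hpush_quasi_iso w qs)).
exists J; split=> //.
have {fw} : dkills (trunc n J) (DMor (hpush_inl s w) (hpush_quasi_iso w qs)).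
  apply: dkills_deq fw _; rewrite /dsum_mor.
  (* The induction runs over sublists J' while the truncation stays at [J], so that it kills every
     term met. *)
  suff H J' : {subset J' <= J} -> dkills (trunc n J)
      (foldr (fun i phi => dadd (dcomp (dloc (free_in n i)) (f i)) phi) (dzero M _) J').
    exact: H.
  elim: J' => [_|i J' IH sJ] /=; first exact: dkills_zero.
  apply: dkills_add; last by apply: IH => j jJ; apply: sJ; rewrite inE jJ orbT.
  apply: dkills_dloc_comp => j x; apply: finsuppP => m /=.
  case: ifP => // mJ; apply: dfwith_out; apply: contraFneq mJ => <-.
  by apply: sJ; rewrite inE eqxx.
(* Up to homotopy, q' after the truncation of w is t on the right leg after w, hence t on the left
   leg after s, and [tn] kills it. *)
move=> [R [t [q' [qq' tq tn]]]]; rewrite /= in t tq tn.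
apply/lnull_rnull; apply: (lnull_qis qq'); apply: lnull_zero.
apply: homotopic_trans (homotopic_compr w (homotopic_sym tq)) _.
apply: homotopic_trans (homotopic_compl t (homotopic_sym (hpush_homotopic s w))) _.
exact: (null_compr s tn).
Qed.

End FreeModules.

(** * Finite subsums, and stability of finite factorization under fibres *)

Section FiniteFactor.
Variables (k : fieldType) (A : dgAlgebra k).
Implicit Types M N P Q T X Y Z K : dgModule A.

Lemma add_regular_shift n : add_regular (shift n (dgm_regular A)).
Proof. exact/AddShift/AddRegular. Qed.

Section FiniteModule.
Variables (I : eqType) (n : I -> int).

Fixpoint finite_module (J : seq I) : dgModule A :=
  if J is i :: J' then dsum (shift (n i) (dgm_regular A)) (finite_module J')
  else dgm_zero A.

Lemma finite_module_add_regular J : add_regular (finite_module J).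
Proof.
elim: J => [|i J IH] /=; first exact: AddZero.
by apply: AddSum => //; apply: add_regular_shift.
Qed.

Program Definition free_out i : dgHom (free_module A n) (shift (n i) (dgm_regular A)) :=
  @DGHom k A (free_module A n) (shift (n i) (dgm_regular A)) (fun j c => c i) _ _ _.
Next Obligation. by []. Qed.

Fixpoint finite_proj J : dgHom (free_module A n) (finite_module J) :=
  if J is i :: J' then hom_pair (free_out i) (finite_proj J') else hom_zero _ _.

Fixpoint finite_incl J : dgHom (finite_module J) (free_module A n) :=
  if J is i :: J' then hom_copair (free_in A n i) (finite_incl J') else hom_zero _ _.

Lemma finite_incl_projE J j (c : free_module A n j) m : uniq J ->
  (finite_incl J j (finite_proj J j c) : finsupp _) m = if m \in J then c m else 0.
Proof.
elim: J => [//|i J IH] /andP[iJ /IH {}IH].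
transitivity ((free_in A n i j (c i) : finsupp _) m +
  (finite_incl J j (finite_proj J j c) : finsupp _) m); first by [].
rewrite IH inE; have [->|mi] := eqVneq m i.
  by rewrite (negbTE iJ) [LHS]addr0 /= dfwith_in.
by rewrite /= dfwith_out 1?eq_sym // add0r.
Qed.

Lemma finite_incl_proj J : uniq J ->
  homotopic (hom_add (hom_comp (finite_incl J) (finite_proj J)) (trunc A n J))
    (hom_id (free_module A n)).
Proof.
move=> uJ; apply: homotopic_ext => j c; apply: finsuppP => m.
rewrite finsuppDE (finite_incl_projE c m uJ) /=.
by case: ifP; rewrite ?addr0 ?add0r.
Qed.

Lemma trunc_comp J J' j (c : free_module A n j) : {subset J <= J'} ->
  trunc A n J' j (trunc A n J j c) = trunc A n J' j c.
Proof.
move=> JJ'; apply: finsuppP => m /=; case: ifP => // /negbT mJ'.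
by rewrite ifN //; apply: contraNN mJ' => /JJ'.
Qed.

Lemma trunc_support j (c : free_module A n j) : exists J : seq I, trunc A n J j c = 0.
Proof.
have [J cJ] := fs_fin c; exists J; apply: finsuppP => m /=.
by case: ifP => // /negbT/cJ.
Qed.

Lemma trunc_null_subset M (f : dgHom M (free_module A n)) J J' : {subset J <= J'} ->
  homotopic (hom_comp (trunc A n J) f) (hom_zero _ _) ->
  homotopic (hom_comp (trunc A n J') f) (hom_zero _ _).
Proof.
move=> JJ' /(null_compl (trunc A n J')); apply: homotopic_trans.
by apply: homotopic_ext => i x; exact: (esym (trunc_comp _ JJ')).
Qed.

End FiniteModule.

(** What is needed of a finite sum of suspensions of A as the kernel part of a fibre. Lifting and
    finiteness are asked together because [u] lives on the source of [s], so only a lift of [v] can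
    be composed with it. *)
Definition small K := forall T T' (s : dgHom T' T), quasi_iso s ->
  forall v : dgHom K T, forall (I : eqType) (n : I -> int) (u : dgHom T' (free_module A n)),
  exists (v' : dgHom K T') (J : seq I),
    homotopic (hom_comp s v') v /\
    homotopic (hom_comp (trunc A n J) (hom_comp u v')) (hom_zero _ _).

(** The generator decides everything: its image lifts to a cocycle through the quasi-isomorphism,
    and the image of this one cocycle in the free module has finite support. *)
Lemma small_free_generator K d (e : K d) : free_generator e -> small K.
Proof.
move=> fe T T' s qs v I n u.
have [t ct tv] := quasi_iso_surj qs (hom_cocycle v (proj1 fe)).
have [v' v'E] := free_generator_hom fe ct.
have [J uJ] := trunc_support (u _ t).
exists v', J; split; apply: (free_generator_homotopic fe).
  by rewrite /= v'E.
have -> : hom_comp (trunc A n J) (hom_comp u v') d e = 0.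
  exact: (etrans (congr1 (fun z => trunc A n J d (u d z)) v'E) uJ).
exact: cohomologous_refl.
Qed.

Lemma small_sum K K1 K2 (i1 : dgHom K1 K) (i2 : dgHom K2 K)
    (p1 : dgHom K K1) (p2 : dgHom K K2) :
  homotopic (hom_add (hom_comp i1 p1) (hom_comp i2 p2)) (hom_id K) ->
  small K1 -> small K2 -> small K.
Proof.
move=> ip sK1 sK2 T T' s qs v I n u.
have [v1 [J1 [sv1 uv1]]] := sK1 _ _ s qs (hom_comp v i1) _ _ u.
have [v2 [J2 [sv2 uv2]]] := sK2 _ _ s qs (hom_comp v i2) _ _ u.
exists (hom_add (hom_comp v1 p1) (hom_comp v2 p2)), (J1 ++ J2); split.
  have sv := homotopic_add (homotopic_compr p1 sv1) (homotopic_compr p2 sv2).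
  apply: homotopic_trans (homotopic_trans (homotopic_ext _) sv) _.
    by move=> i x; exact: (homD s _ _).
  apply: homotopic_trans (homotopic_compl v ip).
  by apply: homotopic_ext => i x; exact: (esym (homD v _ _)).
have {}uv1 : homotopic (hom_comp (trunc A n (J1 ++ J2)) (hom_comp u v1)) (hom_zero _ _).
  by apply: trunc_null_subset uv1 => i iJ; rewrite mem_cat iJ.
have {}uv2 : homotopic (hom_comp (trunc A n (J1 ++ J2)) (hom_comp u v2)) (hom_zero _ _).
  by apply: trunc_null_subset uv2 => i iJ; rewrite mem_cat iJ orbT.
have uv := homotopic_add (null_compr p1 uv1) (null_compr p2 uv2).
apply: homotopic_trans (homotopic_trans (homotopic_ext _) uv) (homotopic_ext _).
  move=> i x; exact: (etrans (congr1 (trunc A n (J1 ++ J2) i) (homD u _ _)) (homD _ _ _)).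
by move=> i x; apply: addr0.
Qed.

Lemma small_shift_zero n : small (shift n (dgm_zero A)).
Proof.
move=> T T' s qs v I m u; exists (hom_zero _ _), [::]; split.
  apply: homotopic_ext => i x /=.
  by rewrite hom0 (row0_eq x 0); apply: (esym (hom0 v i)).
apply: homotopic_ext => i x.
exact: (etrans (congr1 (trunc A m [::] i) (hom0 u i)) (hom0 (trunc A m [::]) i)).
Qed.

(** A double suspension is isomorphic to a single one, along which the free generator is carried
    back. *)
Lemma small_shift_regular m n : small (shift m (shift n (dgm_regular A))).
Proof.
have [_ [r [re rK]]] := free_generator_shift_regular A (n + m).
pose f := shift_shift m n (dgm_regular A).
pose g i (y : shift (n + m) (dgm_regular A) i) : shift m (shift n (dgm_regular A)) i :=
  @deg_cast k A (dgm_regular A) _ _ (esym (shift_shift_deg i m n)) y.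
have fK i x : g i (f i x) = x by exact: (@deg_castK k A (dgm_regular A)).
have gK i y : f i (g i y) = y by exact: (@deg_castK k A (dgm_regular A)).
apply: (@small_free_generator _ _ (g _ (shift_one A (n + m)))); split.
  move=> j e; rewrite -[LHS]fK hom_d gK.
  rewrite (proj1 (free_generator_shift_regular A (n + m))).
  by rewrite -[RHS]fK hom0.
exists (fun i j E x => r i j E (f j x)); split=> i j E x.
  by rewrite -[LHS]fK hom_act gK re fK.
by rewrite hom_act gK rK.
Qed.

Lemma small_shift_finite_module m (I : eqType) (n : I -> int) J :
  small (shift m (finite_module n J)).
Proof.
elim: J => [|i J IH] /=; first exact: small_shift_zero.
set X := shift (n i) _; set Y := finite_module n J.
apply: (@small_sum (shift m (dsum X Y)) (shift m X) (shift m Y)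
    (shift_hom m (hom_inl X Y)) (shift_hom m (hom_inr X Y))
    (shift_hom m (hom_copair (hom_id X) (hom_zero Y X)))
    (shift_hom m (hom_copair (hom_zero X Y) (hom_id Y)))) => //.
  by apply: homotopic_ext => j [x y]; congr pair; rewrite /= ?addr0 ?add0r.
exact: small_shift_regular.
Qed.

Lemma finite_factor_quasi_iso Z Z' (s : dgHom Z' Z) :
  quasi_iso s -> finite_factor Z -> finite_factor Z'.
Proof.
by move=> qs fZ Z2 t qt; apply: (fZ _ (hom_comp s t)); apply: quasi_iso_comp.
Qed.

(* A map from the fibre to a free module has finite image on K; the rest of it
   extends to the cone of K -> ext w, which is quasi-isomorphic to Z. *)
Lemma finite_factor_ext Z K (w : dgHom Z (shift 1 K)) :
  small K -> finite_factor Z -> finite_factor (ext w).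
Proof.
move=> sK fZ T s qs I n u.
have [v [J0 [sv uv]]] := sK _ _ s qs (ext_in w) _ _ u.
have [e eE] := @cone_lift k A _ _ _ v (hom_comp (trunc A n J0) u) uv.
have [th [qth _]] := cone_ext_in_quasi_iso qs sv.
have [J1 [_ J1e]] := fZ _ th qth _ _ e.
exists (undup (J0 ++ J1)); split; first exact: undup_uniq.
have := rnull_compl (trunc A n (undup (J0 ++ J1))) (rnull_comp (cone_in v) J1e).
apply: rnull_htp; apply: homotopic_ext => i x.
apply: (etrans (trunc_comp _ _)).
  by move=> j jJ; rewrite mem_undup mem_cat jJ orbT.
apply: (etrans (congr1 _ (eE _ _))).
by apply: trunc_comp => j jJ; rewrite mem_undup mem_cat jJ.
Qed.

End FiniteFactor.

(** * The ghost tower *)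

Section Tower.
Variables (k : fieldType) (A : dgAlgebra k).
Implicit Types M N P Q T X Y Z K : dgModule A.

Lemma cocycle_cast M i j (e : i = j) (x : M i) : cocycle x -> cocycle (deg_cast e x).
Proof. by case: j / e. Qed.

Lemma hom_cast M N (f : dgHom M N) i j (e : i = j) (x : M i) :
  f j (deg_cast e x) = deg_cast e (f i x).
Proof. by case: j / e. Qed.

Definition cover_index M : eqType := {j : int & M j}.
Definition cover_deg M (i : cover_index M) : int := - tag i.
Definition cover_module M : dgModule A := free_module A (@cover_deg M).

(* Elements that are not cocycles contribute the value 0. *)
Definition cover_value M (i : cover_index M) : M (- cover_deg i) :=
  deg_cast (esym (opprK (tag i))) (if `[< cocycle (tagged i) >] then tagged i else 0).

Lemma cover_value_cocycle M (i : cover_index M) : cocycle (cover_value i).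
Proof.
rewrite /cover_value; move: (esym _); rewrite /cover_deg; case: i => j x /=.
move: (- - j) => l e; case: l / e => /=.
by case: asboolP => // _; apply: cocycle0.
Qed.

Definition cover M : dgHom (cover_module M) M :=
  sval (cid (free_module_hom (@cover_value_cocycle M))).

Lemma coverE M i : cover M _ (free_gen A (@cover_deg M) i) = cover_value i.
Proof. exact: (svalP (cid (free_module_hom (@cover_value_cocycle M))) i). Qed.

Lemma cover_surj M j (x : M j) : cocycle x ->
  exists2 y, cocycle y & cover M j y = x.
Proof.
move=> cx; pose i : cover_index M := Tagged (fun j => M j) x.
have e : - cover_deg i = j by rewrite /cover_deg opprK.
exists (deg_cast e (free_gen A (@cover_deg M) i)).
  exact/cocycle_cast/free_gen_cocycle.
rewrite hom_cast coverE /cover_value; case: asboolP => //= _.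
exact: deg_castK.
Qed.

(** The steps of the tower are ghosts: each cocycle is a value of the cover on a cocycle, and the
    cover becomes null in its cone. *)
Lemma cone_in_cover_zero M : cohomology_zero (cone_in (cover M)).
Proof.
move=> i x cx; have [y cy <-] := cover_surj cx.
exact/cohomologous0/(homotopic_coh (cone_null (cover M)) cy).
Qed.

Fixpoint tower M n : dgModule A :=
  if n is m.+1 then cone (cover (tower M m)) else M.

Fixpoint tower_map M n : dgHom M (tower M n) :=
  if n is m.+1 then hom_comp (cone_in (cover (tower M m))) (tower_map M m)
  else hom_id M.

(** Composition of fractions introduces homotopy pushouts, so the composite of the steps has a
    nontrivial denominator; the homotopy says that it still represents [tower_map]. *)
Lemma tower_ghost_composite M n : exists phi : dmor M (tower M n),
  ghost_composite n phi /\ homotopic (hom_comp (dden phi) (tower_map M n)) (dnum phi).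
Proof.
elim: n => [|n [phi [gphi tphi]]].
  by exists (did M); split; [exact: GhostComposite0 | exact: homotopic_refl].
exists (dcomp (dloc (cone_in (cover (tower M n)))) phi); split.
  apply: GhostCompositeS => // i x y cx cy /cohomologous_cob; apply.
  exact: cone_in_cover_zero.
set g := cone_in _.
apply: homotopic_trans (homotopic_compl (hpush_inl (dden phi) g) tphi).
exact: (homotopic_sym (homotopic_compr (tower_map M n) (hpush_homotopic (dden phi) g))).
Qed.

(** Serves to check the squares of a cone triangle. Denominators are only pointwise identities
    because the suspension of an identity, which occurs in the last square, is not literally
    [hom_id]. *)
Lemma dcomp_strict_deq X Y Y' W (f : dgHom X Y) (g : dgHom Y W) (d : dgHom W W)
    (qd : quasi_iso d) (f' : dgHom X Y') (g' : dgHom Y' W) (d' : dgHom W W)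
    (qd' : quasi_iso d') :
  (forall i x, d i x = x) -> (forall i x, d' i x = x) ->
  (forall i x, g i (f i x) = g' i (f' i x)) ->
  deq (dcomp (DMor g qd) (dloc f)) (dcomp (DMor g' qd') (dloc f')).
Proof.
move=> dE d'E gf.
have [u [ul ur]] := @hpush_lift k A _ _ _ _ (hom_id Y) g g (hom_id W) (homotopic_refl _).
have [u' [ul' ur']] := @hpush_lift k A _ _ _ _ (hom_id Y') g' g' (hom_id W) (homotopic_refl _).
exists W, u, u'; split.
- apply: (quasi_iso_htp _ qd); apply: homotopic_ext => i x.
  exact: (esym (ur _ _)).
- apply: homotopic_ext => i x.
  exact: (etrans (ur _ _) (etrans (etrans (dE _ _) (esym (d'E _ _))) (esym (ur' _ _)))).
- apply: homotopic_ext => i x.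
  exact: (etrans (ul _ _) (etrans (gf _ _) (esym (ul' _ _)))).
Qed.

Lemma cone_exact_triangle X Y (f : dgHom X Y) :
  exact_triangle (dloc f) (dloc (cone_in f)) (dloc (cone_out f)).
Proof.
have did_iso M : diso (did M) by exists (did M); split; apply: dcomp_inverse.
exists X, Y, f, (did X), (did Y), (did (cone f)); split=> //.
by split; apply: dcomp_strict_deq.
Qed.

Lemma lnull_tower M n :
  (forall N (phi : dmor M N), ghost_composite n phi -> deq phi (dzero M N)) ->
  lnull (tower_map M n).
Proof.
move=> M0; have [phi [/M0/deq_zero phi0 tphi]] := tower_ghost_composite M n.
exact: (lnull_qis (dden_qis phi) (lnull_htp (homotopic_sym tphi) phi0)).
Qed.

Lemma acyclic_zero : acyclic (dgm_zero A).
Proof. by move=> i x _; rewrite (row0_eq x 0); apply: coboundary0. Qed.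

(** The triangle Q -> hpush s g -> cone has third term [cone s] up to quasi-isomorphism. The case n
    = 0 is separate, as level 1 is not defined by extensions: there Q is acyclic and the pushout is
    that cone. *)
Lemma thick_level_hpush n N P Q (s : dgHom N P) (g : dgHom N Q) :
  thick_level n Q -> smd (@add_regular k A) (cone s) -> thick_level n.+1 (hpush s g).
Proof.
have smd_iso X Y (f : dgHom X Y) (C : dgModule A -> Prop) :
    quasi_iso f -> smd C Y -> smd C X.
  by move=> /quasi_iso_disom/disomorphic_sym; apply: SmdIso.
move=> tQ sF; have {}sF := smd_iso _ _ _ _ (cone_hpush_inr_quasi_iso s g) sF.
case: n tQ => [/disomorphic_zero aQ|n tQ].
  exact: (smd_iso _ _ _ _ (cone_in_quasi_iso _ aQ) sF).
apply: SmdIn; exists Q, (cone (hpush_inr s g)), (dloc (hpush_inr s g)),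
  (dloc (cone_in (hpush_inr s g))), (dloc (cone_out (hpush_inr s g))).
by split=> //; apply: cone_exact_triangle.
Qed.

Lemma tower_factor M n Z (f : dgHom Z M) :
  finite_factor Z -> rnull (hom_comp (tower_map M n) f) ->
  exists Z' (s : dgHom Z' Z) X (a : dgHom Z' X) (b : dgHom X M),
    [/\ quasi_iso s, thick_level n X & homotopic (hom_comp b a) (hom_comp f s)].
Proof.
elim: n Z f => [|n IH] Z f fZ [Z1 [s1 [q1 f1]]].
  (* The tower starts with the identity of M, so f itself vanishes on Z1 and factors through
     zero. *)
  exists Z1, s1, (dgm_zero A), (hom_zero _ _), (hom_zero _ _); split=> //.
    exact/acyclic_dzero/acyclic_zero.
  exact: (homotopic_trans (homotopic_refl _) (homotopic_sym f1)).
(* Vanishing in the cone of the cover lifts the map to the cover; after refining by [s2], the lift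
   lives on a finite subsum F. *)
have [w pw] := @cone_colift k A _ _ _ (cover (tower M n))
  (hom_comp (tower_map M n) (hom_comp f s1)) f1.
have [J [uJ [Z2 [s2 [q2 w2]]]]] := fZ _ s1 q1 _ _ w.
set d := @cover_deg (tower M n) in J uJ w w2 pw *.
set F := finite_module A d J.
pose w' : dgHom Z2 F := hom_comp (finite_proj A d J) (hom_comp w s2).
have w'E : homotopic (hom_comp (finite_incl A d J) w') (hom_comp w s2).
  have := homotopic_add (homotopic_refl (hom_comp (finite_incl A d J) w'))
    (homotopic_sym w2).
  move=> ww; apply: homotopic_trans (homotopic_trans (homotopic_ext _) ww) _.
    by move=> i x; exact: (esym (addr0 _)).
  exact: (homotopic_compr (hom_comp w s2) (finite_incl_proj A d uJ)).
pose f2 := hom_comp f (hom_comp s1 s2).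
(* On the fibre of w' the map to stage n is null, since up to homotopy it passes through w'; the
   induction hypothesis therefore applies to the fibre. *)
have fib0 : rnull (hom_comp (tower_map M n) (hom_comp f2 (fib_out w'))).
  exists (fib w'), (hom_id _); split; first exact: quasi_iso_id.
  apply: homotopic_trans (homotopic_compr (hom_comp s2 (fib_out w')) (homotopic_sym pw)) _.
  apply: homotopic_trans (homotopic_compr (fib_out w')
    (homotopic_compl (cover (tower M n)) (homotopic_sym w'E))) _.
  exact: (null_compl (hom_comp (cover (tower M n)) (finite_incl A d J)) (fib_null w')).
have fZ2 : finite_factor Z2.
  exact: (finite_factor_quasi_iso (quasi_iso_comp q1 q2) fZ).
have fF : finite_factor (fib w').
  by apply: finite_factor_ext => //; apply: small_shift_finite_module.
have [Z3 [s3 [X [a [b [q3 tX ba]]]]]] := IH _ _ fF fib0.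
(* The maps f2 on Z2 and b on X agree on Z3 up to homotopy, so they glue to [c] on the pushout,
   whose left leg factors f2. *)
have [c [ci cj]] := hpush_lift (homotopic_sym ba
  : homotopic (hom_comp f2 (hom_comp (fib_out w') s3)) (hom_comp b a)).
exists Z2, (hom_comp s1 s2), (hpush (hom_comp (fib_out w') s3) a),
  (hpush_inl _ _), c; split.
- exact: quasi_iso_comp.
- apply: thick_level_hpush => //.
  (* The cone of Z3 -> Z2 is F up to quasi-isomorphism, so passing to the pushout costs one
     level. *)
  have [u qu] := cone_ext_out_quasi_iso q3.
  apply: SmdIso (SmdIn (finite_module_add_regular A d J)).
  exact: (quasi_iso_disomorphic (unshift_quasi_iso F) qu).
- by apply: homotopic_ext => i x; exact: (ci _ _).
Qed.

(** By [retract_quasi_iso], N is a direct summand of X in D(A). Positive levels are closed under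
    summands by construction; for level 0 acyclicity is checked directly. *)
Lemma thick_level_retract n M N X (a : dgHom M X) (b : dgHom X N) :
  quasi_iso (hom_comp b a) -> thick_level n X -> thick_level n N.
Proof.
move=> qba; have qX := retract_quasi_iso qba.
have smdX C : smd C X -> smd C N.
  move=> sX; apply: SmdSummand.
  exact: SmdIso (quasi_iso_disom qX) sX.
case: n => [/disomorphic_zero aX|[|n]]; [|exact: smdX | exact: smdX].
apply: acyclic_dzero => i y cy; have [x cx xy] := quasi_iso_surj qba cy.
apply: (cohomologous_cob xy).
exact: (hom_coboundary b (aX _ _ (hom_cocycle a cx))).
Qed.

Lemma compact_converse_ghost_lemma M n : compact_object M ->
  (forall N (phi : dmor M N), ghost_composite n phi -> deq phi (dzero M N)) ->
  thick_level n M.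
Proof.
move=> /compact_finite_factor fM /lnull_tower/lnull_rnull M0.
have [Z' [s [X [a [b [qs tX ba]]]]]] := tower_factor (f := hom_id M) fM M0.
apply: thick_level_retract tX; exact: (quasi_iso_htp (homotopic_sym ba) qs).
Qed.

End Tower.

(** * Ghost length and level *)

Section Lengths.
Variables (k : fieldType) (A : dgAlgebra k).
Implicit Types M N : dgModule A.

Lemma level_min M m : thick_level m M ->
  (forall n, thick_level n M -> (m <= n)%N) -> level M = (m%:Z)%:E%E.
Proof.
move=> tm mmin; rewrite /level /infimum; set S := image _ _.
have Sm : S (m%:Z%:E)%E by exists m.
have lbS : lbound S (m%:Z%:E)%E.
  by move=> _ [n /mmin mn <-]; rewrite lee_fin lez_nat.
case: ifPn => [/eqP S0|_]; first by move: Sm; rewrite S0.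
have inf_m : infimums S (m%:Z%:E)%E by split=> // y /(_ _ Sm).
by case: xgetP => [y _ inf_y|/(_ _ inf_m)//]; apply: (@is_subset1_infimums _ _ S).
Qed.

Lemma level_infty M : (forall n, ~ thick_level n M) -> level M = +oo%E.
Proof.
move=> nM; rewrite /level /infimum; set S := image _ _.
case: ifPn => // /set0P[_ [n tn _]].
by case: (nM n).
Qed.

Definition ghosts_vanish n M :=
  forall N (phi : dmor M N), ghost_composite n phi -> deq phi (dzero M N).

Lemma ghosts_vanishS n M : ghosts_vanish n M -> ghosts_vanish n.+1 M.
Proof.
move=> vM N phi; have [m mE] : exists m, m = n.+1 by exists n.+1.
rewrite -mE => gphi; case: gphi mE => // {}m {}N L {}phi psi gphi _ [mn].
rewrite -mn in vM.
apply/deq_zero; have /deq_zero/lnull_rnull := vM _ _ gphi.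
move=> /(rnull_compl (hpush_inl (dden phi) (dnum psi))).
by move=> /lnull_rnull.
Qed.

Lemma ghosts_vanish_leq m n M : (m <= n)%N -> ghosts_vanish m M -> ghosts_vanish n M.
Proof.
move=> /subnK <-; elim: (n - m)%N => // j IH /IH.
exact: ghosts_vanishS.
Qed.

Lemma compact_thick_levelP M n :
  compact_object M -> thick_level n M <-> ghosts_vanish n M.
Proof.
move=> cM; split; last exact: compact_converse_ghost_lemma.
by move=> tM N phi; apply: ghost_lemma.
Qed.

(** The shift by one: m = 0 is the zero object of ghost length -1, and for m + 1 minimality means
    that composites of m ghosts do not all vanish, while those of m + 1 ghosts do. *)
Lemma has_ghost_lengthP M n : compact_object M ->
  has_ghost_length M n <->
  exists m : nat, [/\ n = m%:Z - 1, thick_level m M &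
    forall j, thick_level j M -> (m <= j)%N].
Proof.
move=> cM; have tP j := compact_thick_levelP j cM.
split=> [[[zM ->]|[m [-> vM [N [phi [gphi phi0]]]]]]|[[|m] [-> tM mM]]].
- by exists 0%N.
- exists m.+1; split; [by rewrite -addn1 PoszD addrK | exact/tP | move=> j /tP vj].
  rewrite ltnNge; apply/negP => jm; apply: phi0.
  exact: (ghosts_vanish_leq jm vj).
- by left.
right; exists m; split; first by rewrite -addn1 PoszD addrK.
  by apply/tP.
(* If no composite of m ghosts were nonzero, M would already lie in level m, against the minimality
   of m + 1. *)
apply: contrapT => nM; have /mM : thick_level m M; last by rewrite ltnn.
apply/tP => N phi gphi; apply: contrapT => phi0; apply: nM.
by exists N, phi.
Qed.

End Lengths.

Theorem proposition3p12 (k : closedFieldType) (k_char0 : [pchar k] =i pred0)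
    (A : dgAlgebra k) (A_connected : connected_dga A)
    (M : dgModule A) (M_compact : compact_object M) :
  gh_len M = (level M - 1%:E)%E.
Proof.
have lenP n := has_ghost_lengthP n M_compact.
have [[m tm]|noM] := pselect (exists n, thick_level n M); last first.
  have {}noM n : ~ thick_level n M by move=> tn; apply: noM; exists n.
  (* Without a finite level there is no ghost length, so [gh_len] takes its default value and both
     sides are infinite. *)
  rewrite level_infty //= /gh_len; case: xgetP => // y _ [n /lenP[j [_ tj _]] _].
  by case: (noM j).
have exM : exists n, `[< thick_level n M >] by exists m; apply/asboolP.
have [{tm}m /asboolP tm mmin] := ex_minnP exM.
have {}mmin n : thick_level n M -> (m <= n)%N by move=> /asboolP/mmin.
rewrite (level_min tm mmin) /gh_len.
(* Any ghost length picked by [xget] is j - 1 with j a least level, hence j = m; and m - 1 is one,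
   so the default value does not occur. *)
case: xgetP => [y _ [n /lenP[j [-> tj jmin]] <-]|/(_ (m%:Z - 1)%:E%E)[]].
  by rewrite (_ : j = m) //; apply/eqP; rewrite eqn_leq jmin // mmin.
by exists (m%:Z - 1) => //; apply/lenP; exists m.
Qed.
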